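(* There exist a compact set $E \subset \mathbb{C}$ and a holomorphic motion $h:\mathbb{D} \times \widehat{\mathbb{C}} \to \widehat{\mathbb{C}}$ such that $h(\lambda,\infty)=\infty$ for all $\lambda \in \mathbb{D}$, but the function $$\lambda \mapsto \gamma(E_\lambda) \qquad (\lambda \in \mathbb{D})$$ is not continuous on $\mathbb{D}$, where $E_\lambda:=\{h(\lambda,z):z\in E\}$ and $\gamma$ denotes analytic capacity.
   Context: $\mathbb{D}$ is the open unit disk in $\mathbb{C}$ and $\widehat{\mathbb{C}}=\mathbb{C}\cup\{\infty\}$ is the Riemann sphere. A holomorphic motion of a set $A\subset\widehat{\mathbb{C}}$ is a map $h:\mathbb{D}\times A\to\widehat{\mathbb{C}}$ such that: (i) for each fixed $z\in A$, the map $\lambda\mapsto h(\lambda,z)$ is holomorphic on $\mathbb{D}$ (as a map into $\widehat{\mathbb{C}}$); (ii) for each fixed $\lambda\in\mathbb{D}$, the map $z\mapsto h(\lambda,z)$ is injective on $A$; (iii) $h(0,z)=z$ for all $z\in A$. By the $\lambda$-lemma of Mañé, Sad and Sullivan, a holomorphic motion of $\widehat{\mathbb{C}}$ is jointly continuous in $(\lambda,z)$; in particular each $E_\lambda$ above is a compact subset of $\mathbb{C}$. The analytic capacity of a compact set $K\subset\mathbb{C}$ is $\gamma(K):=\sup_g|g'(\infty)|$, where the supremum is over all holomorphic functions $g:\widehat{\mathbb{C}}\setminus K\to\mathbb{D}$ and $g'(\infty):=\lim_{z\to\infty}z\,(g(z)-g(\infty))$. *)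

(* Defs.v *)
From HB Require Import structures.
From mathcomp Require Import all_boot all_order all_algebra complex.
From mathcomp Require Import all_classical all_reals all_analysis.

Set Implicit Arguments.
Unset Strict Implicit.
Unset Printing Implicit Defensive.

Import Order.TTheory GRing.Theory Num.Theory numFieldNormedType.Exports.

Local Open Scope classical_set_scope.
Local Open Scope complex_scope.
Local Open Scope ring_scope.

(* The alias [^o] makes R[i] a normed space over itself, so that [derivable]
   on Cplx is complex differentiability. *)
Notation Cplx R := (R[i]^o) (only parsing).

Notation sphere R := (one_point_compactification (Cplx R)) (only parsing).

Section Sphere.
Variable R : realType.

Definition fin (z : Cplx R) : sphere R := Some z.

Definition infty : sphere R := None.

(* [chart0] is the coordinate z on sphere \ {infty}, with inverse [fin];
   [chart1] is the coordinate 1/z on sphere \ {0}, with inverse [fin_inv].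
   The values chart0 infty and chart1 0 are junk and are never used. *)
Definition chart0 (p : sphere R) : Cplx R := if p is Some z then z else 0.

Definition chart1 (p : sphere R) : Cplx R :=
  if p is Some z then (z : R[i])^-1 else 0.

Definition fin_inv (w : Cplx R) : sphere R :=
  if w == 0 then infty else fin (w : R[i])^-1.

Definition complex_differentiable (f : Cplx R -> Cplx R) (a : Cplx R) : Prop :=
  derivable f a 1.

Definition holomorphic_to_sphere (U : set (Cplx R)) (f : Cplx R -> sphere R)
  : Prop :=
  forall a, U a ->
    [/\ {for a, continuous f},
        f a <> infty -> complex_differentiable (chart0 \o f) a
      & f a <> fin 0 -> complex_differentiable (chart1 \o f) a].

Definition holomorphic_on_sphere (U : set (sphere R)) (g : sphere R -> Cplx R)
  : Prop :=
  (forall z, U (fin z) -> complex_differentiable (g \o fin) z) /\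
  (forall w, U (fin_inv w) -> complex_differentiable (g \o fin_inv) w).

Definition unit_disk : set (Cplx R) := [set z | `|z| < 1].

(* Only the values of [h] on unit_disk x A are constrained. *)
Definition holomorphic_motion (A : set (sphere R))
    (h : Cplx R -> sphere R -> sphere R) : Prop :=
  [/\ forall p, A p -> holomorphic_to_sphere unit_disk (h ^~ p),
      forall lam, unit_disk lam ->
        forall p q, A p -> A q -> h lam p = h lam q -> p = q
    & forall p, A p -> h 0 p = p].

Definition deriv_at_infty (g : sphere R -> Cplx R) : Cplx R :=
  lim ((fun p : sphere R =>
          (chart0 p : R[i]) * (g p - g infty) : Cplx R) @ infty^').

Definition analytic_capacity (K : set (Cplx R)) : \bar R :=
  ereal_sup [set (complex.Re `|deriv_at_infty g|)%:E | g in
    [set g : sphere R -> Cplx R |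
      holomorphic_on_sphere (~` (fin @` K)) g /\
      forall p, (~` (fin @` K)) p -> unit_disk (g p)]].

(* The finite part of {h(lam, z) : z in E}, which is all of it when
   h lam is injective and fixes infinity. *)
Definition moved_set (h : Cplx R -> sphere R -> sphere R) (E : set (Cplx R))
    (lam : Cplx R) : set (Cplx R) :=
  fin @^-1` (h lam @` (fin @` E)).

End Sphere.

(* Main.v *)
Require Import Defs.
From mathcomp Require Import all_boot all_order all_algebra complex.
From mathcomp Require Import all_classical all_reals all_analysis.
From mathcomp Require Import ring lra.
Import Order.TTheory GRing.Theory Num.Theory numFieldNormedType.Exports.
Set Implicit Arguments.
Unset Strict Implicit.
Unset Printing Implicit Defensive.
Local Open Scope classical_set_scope.
Local Open Scope complex_scope.
Local Open Scope ring_scope.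

(** Analytic capacity sees length, and the length of a Cantor set of dimension
    one can change abruptly under a holomorphic motion.

    Let E be a Cantor set with 4^n squares of generation n, each of size
    comparable with l n, four children being placed near the corners of each
    square.  The Cauchy transform of the uniform probability measure on E is
    bounded by a multiple of the sum of 4^-n / l n, since at most about
    a fraction 4^-n of the mass lies at distance l n from a given point
    ([center_mean_inv_bound]).  If this sum is finite, a multiple of the
    transform is a competitor in the definition of the capacity, which is
    therefore positive.  On the other hand, if the total length 4^n * l n tends
    to 0 along some generations, the capacity is zero by Painleve's argument
    ([square_int_cantor], [no_residue]): the derivative at infinity of a
    competitor is a contour integral, which Goursat's theorem transports to the
    4^n small squares, where it is at most a constant times 4^n * l n.

    For 4^n * l n = (n + 12)^2 the sum converges.  The motion scales each square
    by a factor s = 1 + lambda / 1000 inside its parent; for real s this turns l n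
    into s^n * l n.  Thus for negative real lambda the length of generation n is
    (n + 12)^2 * s^n, which tends to 0.  So the capacity vanishes for all small
    negative lambda, but not at lambda = 0.

    The motion is given on the whole plane by a power series in s ([flow]), which
    makes the dependence on lambda holomorphic.  Its injectivity rests on
    self-similarity ([flow_in_child]): two points in a common child square can be
    magnified until they separate, and at that scale the motion is a Lipschitz
    perturbation of the identity with a constant less than 1
    ([drift_lipschitz], [flow_separates]). *)

(** * Real-valued moduli, complex derivatives and limits of sequences *)
Section Modulus.
Variable R : realType.
Local Notation C := R[i].
Implicit Types (z w : C) (x y e d : R).

(** Both moduli take real values, unlike the norm of [R[i]], so that
    estimates live in an ordered field.  The multiplicative one serves the
    analysis; the balls of [nrm] are the squares of the construction. *)
Definition cabs (z : C) : R := Normc.normc z.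

Definition nrm (z : C) : R := Num.max `|complex.Re z| `|complex.Im z|.

Lemma normE (z : C) : `|z| = (cabs z)%:C.
Proof. by []. Qed.

Lemma ReD z w : complex.Re (z + w) = complex.Re z + complex.Re w.
Proof. by case: z w => [a b] [c d]. Qed.
Lemma ImD z w : complex.Im (z + w) = complex.Im z + complex.Im w.
Proof. by case: z w => [a b] [c d]. Qed.
Lemma ReN z : complex.Re (- z) = - complex.Re z.
Proof. by case: z. Qed.
Lemma ImN z : complex.Im (- z) = - complex.Im z.
Proof. by case: z. Qed.
Lemma ReM z w : complex.Re (z * w) =
  complex.Re z * complex.Re w - complex.Im z * complex.Im w.
Proof. by case: z w => [a b] [c d]. Qed.
Lemma ImM z w : complex.Im (z * w) =
  complex.Re z * complex.Im w + complex.Im z * complex.Re w.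
Proof. by case: z w => [a b] [c d]. Qed.
Lemma ReC x : complex.Re x%:C = x. Proof. by []. Qed.
Lemma ImC x : complex.Im x%:C = 0. Proof. by []. Qed.

Lemma Ceq z w : complex.Re z = complex.Re w -> complex.Im z = complex.Im w ->
  z = w.
Proof. by case: z w => [a b] [c d] /= -> ->. Qed.

Lemma cabs_ge0 z : 0 <= cabs z.
Proof. by case: z => a b; rewrite /cabs /= sqrtr_ge0. Qed.
Lemma cabs0 : cabs 0 = 0. Proof. exact: Normc.normc0. Qed.
Lemma cabs1 : cabs 1 = 1. Proof. exact: Normc.normc1. Qed.
Lemma cabsM z w : cabs (z * w) = cabs z * cabs w.
Proof. exact: Normc.normcM. Qed.
Lemma cabsV z : cabs z^-1 = (cabs z)^-1.
Proof. exact: Normc.normcV. Qed.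
Lemma cabsX z n : cabs (z ^+ n) = cabs z ^+ n.
Proof.
by elim: n => [|n IH]; rewrite ?expr0 ?cabs1// !exprS cabsM IH.
Qed.
Lemma cabsN z : cabs (- z) = cabs z.
Proof. by case: z => a b; rewrite /cabs /= !sqrrN. Qed.
Lemma cabsD z w : cabs (z + w) <= cabs z + cabs w.
Proof. by rewrite -lecR rmorphD -!normE ler_normD. Qed.
Lemma cabsB z w : cabs (z - w) <= cabs z + cabs w.
Proof. by rewrite (le_trans (cabsD _ _)) ?cabsN. Qed.
Lemma cabsD4 (a b c d : C) x : cabs a <= x -> cabs b <= x -> cabs c <= x ->
  cabs d <= x -> cabs (a + b + c + d) <= 4 * x.
Proof.
move=> ha hb hc hd; have := cabsD (a + b + c) d; have := cabsD (a + b) c.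
have := cabsD a b; lra.
Qed.
Lemma cabs_dist z w : cabs (z - w) = cabs (w - z).
Proof. by rewrite -cabsN opprB. Qed.
Lemma cabs_eq0 z : cabs z = 0 -> z = 0.
Proof. exact: Normc.eq0_normc. Qed.
Lemma cabs_gt0 z : z != 0 -> 0 < cabs z.
Proof.
move=> z0; rewrite lt_neqAle cabs_ge0 andbT eq_sym.
by apply: contra z0 => /eqP/cabs_eq0 ->.
Qed.
Lemma cabs_real x : cabs x%:C = `|x|.
Proof. by rewrite /cabs /= expr0n /= addr0 sqrtr_sqr. Qed.

Lemma Re_le_cabs z : `|complex.Re z| <= cabs z.
Proof.
case: z => a b; rewrite /cabs /= -sqrtr_sqr ler_wsqrtr// lerDl.
exact: sqr_ge0.
Qed.
Lemma Im_le_cabs z : `|complex.Im z| <= cabs z.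
Proof.
case: z => a b; rewrite /cabs /= -(sqrtr_sqr b) ler_wsqrtr// lerDr.
exact: sqr_ge0.
Qed.
Lemma cabs_le_ReIm z : cabs z <= `|complex.Re z| + `|complex.Im z|.
Proof.
rewrite /cabs; case: z => a b /=.
rewrite -[leRHS]ger0_norm ?addr_ge0// -sqrtr_sqr ler_wsqrtr//.
rewrite sqrrD !real_normK ?num_real// -addrA [in leRHS](addrC (_ *+ 2)).
by rewrite addrA lerDl mulrn_wge0// mulr_ge0.
Qed.

Lemma nrm_le z e :
  (nrm z <= e) = (`|complex.Re z| <= e) && (`|complex.Im z| <= e).
Proof. by rewrite /nrm ge_max. Qed.
Lemma nrm_lt z e : (nrm z < e) = (`|complex.Re z| < e) && (`|complex.Im z| < e).
Proof. by rewrite /nrm gt_max. Qed.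
Lemma nrm_Re z :
  `|complex.Re z| <= nrm z. Proof. by rewrite /nrm le_max lexx. Qed.
Lemma nrm_Im z : `|complex.Im z| <= nrm z.
Proof. by rewrite /nrm le_max lexx orbT. Qed.
Lemma nrm_ge0 z : 0 <= nrm z.
Proof. exact: le_trans (normr_ge0 _) (nrm_Re z). Qed.
Lemma nrmN z : nrm (- z) = nrm z.
Proof. by rewrite /nrm ReN ImN !normrN. Qed.
Lemma nrmD z w : nrm (z + w) <= nrm z + nrm w.
Proof.
rewrite nrm_le ReD ImD.
by rewrite !(le_trans (ler_normD _ _))// lerD ?nrm_Re ?nrm_Im.
Qed.
Lemma nrmB z w : nrm (z - w) <= nrm z + nrm w.
Proof. by rewrite (le_trans (nrmD _ _))// nrmN. Qed.
Lemma nrm_real x z : nrm (x%:C * z) = `|x| * nrm z.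
Proof.
rewrite /nrm ReM ImM ReC ImC !mul0r subr0 addr0 !normrM.
by rewrite maxr_pMr.
Qed.
Lemma nrm_cabs z : nrm z <= cabs z.
Proof. by rewrite nrm_le Re_le_cabs Im_le_cabs. Qed.
Lemma cabs_nrm z : cabs z <= 2 * nrm z.
Proof.
by rewrite (le_trans (cabs_le_ReIm _))// mulr2n mulrDl !mul1r lerD ?nrm_Re ?nrm_Im.
Qed.


Lemma ball_cabs (a b : C) x : 0 < x ->
  @ball _ (C^o) a x%:C b = (cabs (a - b) < x) :> Prop.
Proof. by move=> x0; rewrite -ball_normE /ball_ /= normE ltcR. Qed.

Lemma posC (e : C) : 0 < e -> exists2 x : R, 0 < x & e = x%:C.
Proof.
case: e => a b; rewrite ltcE /= => /andP[/eqP b0 a0].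
by exists a => //; rewrite b0.
Qed.

Lemma nbhsCP (a : C^o) (A : set (C^o)) :
  nbhs a A <-> exists2 d : R, 0 < d & forall b, cabs (b - a) < d -> A b.
Proof.
split.
  move=> /nbhs_ballP [e /= /posC [x x0 ->]] sub.
  by exists x => // b bx; apply: sub; rewrite ball_cabs// cabs_dist.
move=> [d d0 H]; apply/nbhs_ballP; exists d%:C; first by rewrite /= ltcR.
by move=> b; rewrite ball_cabs// cabs_dist; exact: H.
Qed.

Lemma cvgCP (T : Type) (F : set_system T) (f : T -> C^o) (l : C) :
  Filter F ->
  f @ F --> (l : C^o) <-> forall e : R, 0 < e -> F [set x | cabs (f x - l) <= e].
Proof.
move=> FF; split.
  move=> H e e0; apply: (H [set x | cabs (x - l) <= e]).
  by apply/nbhsCP; exists e => // b /ltW.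
move=> H A /nbhsCP[d d0 dA].
have d2 : 0 < d / 2 by lra.
suff : F [set x | A (f x)] by [].
apply: filterS (H _ d2).
move=> x /= fx; apply: dA; apply: (le_lt_trans fx); lra.
Qed.

(** Epsilon-delta form of complex differentiability: a derivative given by
    explicit inequalities survives passage to the limit. *)
Definition has_deriv (f : C -> C) (a l : C) :=
  forall e : R, 0 < e -> exists2 d : R, 0 < d &
    forall h, cabs h < d -> cabs (f (a + h) - f a - l * h) <= e * cabs h.

Lemma complex_differentiableP (f : Cplx R -> Cplx R) (a : Cplx R) :
  complex_differentiable f a <-> exists l, has_deriv f a l.
Proof.
split.
  move=> /cvg_ex [l /= /cvgCP H]; exists l => e e0.
  have /nbhsCP[d d0 dH] := H e e0.
  exists d => // h hd.
  have [->|h0] := eqVneq h 0; first by rewrite addr0 mulr0 !subrr cabs0 mulr0.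
  have := dH h; rewrite subr0 => /(_ hd h0).
  rewrite /= -[_ *: _]/(_ * _) -[h *: 1]/(h * 1) mulr1.
  move=> /(ler_wpM2r (cabs_ge0 h)); apply: le_trans.
  rewrite -cabsM mulrBl mulrAC mulVf// mul1r.
  by rewrite [h + a]addrC.
move=> [l H]; apply/cvg_ex; exists l; apply/cvgCP => e e0.
have [d d0 dH] := H e e0.
apply/nbhsCP; exists d => // h; rewrite subr0 => hd h0 /=.
rewrite /= -[_ *: _]/(_ * _) -[h *: 1]/(h * 1) mulr1.
rewrite -(ler_pM2r (cabs_gt0 h0)) -cabsM mulrBl mulrAC mulVf// mul1r.
by rewrite [h + a]addrC; apply: dH.
Qed.

Lemma has_deriv_cont (f : C -> C) a l : has_deriv f a l ->
  forall e : R, 0 < e -> exists2 d : R, 0 < d &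
    forall h, cabs h < d -> cabs (f (a + h) - f a) <= e.
Proof.
move=> H e e0; have [d d0 dH] := H 1 ltr01.
have k0 : 0 < 1 + cabs l by rewrite ltr_wpDr ?cabs_ge0.
exists (Num.min d (e / (1 + cabs l))); first by rewrite lt_min d0 divr_gt0.
move=> h; rewrite lt_min => /andP[hd]; rewrite ltr_pdivlMr// => he.
have := dH h hd => h1.
have -> : f (a + h) - f a = (f (a + h) - f a - l * h) + l * h by ring.
apply: le_trans (cabsD _ _) _; rewrite cabsM; nra.
Qed.

Lemma has_deriv_cst (c : C) a : has_deriv (fun=> c) a 0.
Proof.
move=> e e0; exists 1 => // h _.
by rewrite subrr mul0r subr0 cabs0 mulr_ge0 ?cabs_ge0// ltW.
Qed.

Lemma has_deriv_affine (c b : C) a : has_deriv (fun z => c + b * z) a b.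
Proof.
move=> e e0; exists 1 => // h _.
have -> : c + b * (a + h) - (c + b * a) - b * h = 0 by ring.
by rewrite cabs0 mulr_ge0 ?cabs_ge0// ltW.
Qed.

Lemma has_deriv_eq (f g : C -> C) a l : (forall z, f z = g z) ->
  has_deriv f a l -> has_deriv g a l.
Proof.
move=> fg H e e0; have [d d0 dH] := H e e0.
by exists d => // h /dH; rewrite !fg.
Qed.

Lemma has_deriv_near (f g : C -> C) a l d0 : 0 < d0 ->
  (forall z, cabs (z - a) < d0 -> f z = g z) ->
  has_deriv f a l -> has_deriv g a l.
Proof.
move=> d00 fg H e e0; have [d dp dH] := H e e0.
exists (Num.min d d0); first by rewrite lt_min dp.
move=> h; rewrite lt_min => /andP[/dH + hd].
by rewrite -!fg// ?[a + h]addrC ?addrK ?subrr ?cabs0.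
Qed.

Lemma has_deriv_comp (f g : C -> C) a l m :
  has_deriv g a m -> has_deriv f (g a) l -> has_deriv (f \o g) a (l * m).
Proof.
move=> Hg Hf e e0.
pose k := 1 + cabs l + cabs m.
have k0 : 0 < k by rewrite /k; have := cabs_ge0 l; have := cabs_ge0 m; lra.
have e1 : 0 < e / (k + k) by rewrite divr_gt0// addr_gt0.
have [d1 d10 H1] := Hg _ e1.
have [d2 d20 H2] := Hf _ e1.
have [d3 d30 H3] := has_deriv_cont Hg (e := d2 / 2) (ltac:(by rewrite divr_gt0)).
have [d4 d40 H4] := Hg 1 ltr01.
exists (Num.min (Num.min d1 d3) d4); first by rewrite !lt_min d10 d30.
move=> h; rewrite !lt_min => /andP[/andP[h1 h3] h4].
have {}H1 := H1 _ h1; have {}H3 := H3 _ h3; have {}H4 := H4 _ h4.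
set k1 := g (a + h) - g a in H1 H3 H4.
have hk1 : cabs k1 < d2 by lra.
have {}H2 := H2 _ hk1.
have E : g a + k1 = g (a + h) by rewrite /k1; ring.
rewrite E in H2.
have -> : (f \o g) (a + h) - (f \o g) a - l * m * h =
  (f (g (a + h)) - f (g a) - l * k1) + l * (k1 - m * h) by rewrite /=; ring.
apply: le_trans (cabsD _ _) _; rewrite cabsM.
have K1 : cabs k1 <= (1 + cabs m) * cabs h.
  have -> : k1 = (k1 - m * h) + m * h by ring.
  apply: le_trans (cabsD _ _) _; rewrite cabsM; lra.
have el : e / (k + k) * (k + k) = e by rewrite divfK// gt_eqF// addr_gt0.
set e' := e / (k + k) in e1 H1 H2 el.
have h0 := cabs_ge0 h; have l0 := cabs_ge0 l; have m0 := cabs_ge0 m.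
have : cabs l * cabs (k1 - m * h) <= cabs l * (e' * cabs h) by apply: ler_wpM2l.
have : e' * cabs k1 <= e' * ((1 + cabs m) * cabs h) by rewrite ler_wpM2l// ltW.
have : 0 <= e' * cabs h by rewrite mulr_ge0// ltW.
rewrite -el /k => *; nra.
Qed.

Lemma has_deriv_inv (a : C) : a != 0 -> has_deriv (fun z => z^-1) a (- a^-2).
Proof.
move=> a0 e e0; have ca := cabs_gt0 a0.
pose d := Num.min (cabs a / 2) (e * cabs a ^+ 3 / 2).
exists d; first by rewrite /d lt_min !divr_gt0// mulr_gt0// exprn_gt0.
move=> h; rewrite /d lt_min => /andP[h1 h2].
have b1 : cabs a / 2 < cabs (a + h).
  have -> : cabs a = cabs ((a + h) - h) by rewrite addrK.
  have := cabsB (a + h) h; rewrite addrK => ?; lra.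
have b0 : a + h != 0.
  by apply/eqP => E; move: b1; rewrite E cabs0; lra.
have -> : (a + h)^-1 - a^-1 - - a^-2 * h = h ^+ 2 * (a + h)^-1 * a^-2.
  by field; rewrite a0 b0.
have c0 : 0 < cabs (a + h) by lra.
rewrite !cabsM !cabsV !cabsX.
rewrite expr2 -!mulrA [leRHS]mulrC ler_wpM2l ?cabs_ge0//.
rewrite -invfM ler_pdivrMr; last by rewrite !mulr_gt0.
apply: (le_trans (ltW h2)); rewrite -mulrA ler_wpM2l// ?ltW// exprS expr2.
have : 0 < cabs a * cabs a by rewrite mulr_gt0.
nra.
Qed.

Definition tends (u : nat -> C) (l : C) :=
  forall e : R, 0 < e -> exists N, forall n, (N <= n)%N -> cabs (u n - l) <= e.

Lemma tends_le (u : nat -> C) l N x : tends u l ->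
  (forall n, (N <= n)%N -> cabs (u n) <= x) -> cabs l <= x.
Proof.
move=> ul H; apply/ler_addgt0Pr => e e0.
have [M HM] := ul e e0.
have := HM (maxn M N) (leq_maxl _ _); have := H (maxn M N) (leq_maxr _ _).
set v := u _ => h1 h2.
have -> : l = v - (v - l) by ring.
by apply: le_trans (cabsB _ _) _; exact: lerD.
Qed.

Lemma tends_cst l : tends (fun=> l) l.
Proof. by move=> e e0; exists 0%N => n _; rewrite subrr cabs0 ltW. Qed.

Lemma tendsD u v l m : tends u l -> tends v m ->
  tends (fun n => u n + v n) (l + m).
Proof.
move=> H K e e0; have e2 : 0 < e / 2 by rewrite divr_gt0.
have [N1 H1] := H _ e2; have [N2 H2] := K _ e2.
exists (maxn N1 N2) => n; rewrite geq_max => /andP[n1 n2].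
have -> : u n + v n - (l + m) = (u n - l) + (v n - m) by ring.
apply: le_trans (cabsD _ _) _; have := H1 _ n1; have := H2 _ n2; lra.
Qed.

Lemma tendsZ u l c : tends u l -> tends (fun n => c * u n) (c * l).
Proof.
move=> H e e0; have k0 : 0 < 1 + cabs c by rewrite ltr_wpDr ?cabs_ge0.
have [N HN] := H (e / (1 + cabs c)) (divr_gt0 e0 k0).
exists N => n /HN; rewrite -mulrBr cabsM ler_pdivlMr// => h.
have := cabs_ge0 (u n - l); nra.
Qed.

Lemma tends_unique u l m : tends u l -> tends u m -> l = m.
Proof.
move=> H K; have K' := tendsZ (-1) K.
have /= HK := tendsD H K'.
apply/eqP; rewrite -subr_eq0; apply/eqP/cabs_eq0/eqP.
rewrite eq_le cabs_ge0 andbT.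
have := tends_le (N := 0%N) (x := 0) HK.
rewrite mulN1r; apply => n _; by rewrite mulN1r subrr cabs0.
Qed.

Lemma tends_eq (u v : nat -> C) l : (forall n, u n = v n) -> tends u l ->
  tends v l.
Proof. by move=> /funext ->. Qed.

Lemma tends_shift u l : tends (fun n => u n.+1) l <-> tends u l.
Proof.
split=> H e e0; have [N HN] := H e e0.
  by exists N.+1 => -[//|n] nN; exact: HN.
by exists N => n nN; apply: HN; rewrite ltnW.
Qed.

(** The numbers u n - 2 x / 2^n increase and the numbers u n + 2 x / 2^n
    decrease, so the supremum of the former is caught between them. *)
Lemma real_geom_cauchy (u : nat -> R) x :
  (forall n, `|u n.+1 - u n| <= x / 2 ^+ n) ->
  exists l, forall n, `|u n - l| <= 2 * x / 2 ^+ n.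
Proof.
move=> H.
have x0 : 0 <= x by have := H 0%N; rewrite expr0 divr1; apply: le_trans.
have P n : 0 < (2:R) ^+ n by rewrite exprn_gt0.
have E n : 2 * x / 2 ^+ n = x / 2 ^+ n + 2 * x / 2 ^+ n.+1.
  by rewrite exprS; field; rewrite gt_eqF.
have dec n k : u n - 2 * x / 2 ^+ n <= u (n + k)%N - 2 * x / 2 ^+ (n + k) /\
               u (n + k)%N + 2 * x / 2 ^+ (n + k) <= u n + 2 * x / 2 ^+ n.
  elim: k => [|k [IH1 IH2]]; first by rewrite addn0.
  rewrite addnS.
  have := E (n + k)%N; have := H (n + k)%N; rewrite ler_norml => /andP[h1 h2] h3.
  split; lra.
have pos n : 0 <= 2 * x / 2 ^+ n by rewrite !mulr_ge0// invr_ge0 ltW.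
have ub m n : u n - 2 * x / 2 ^+ n <= u m + 2 * x / 2 ^+ m.
  have [nm|/ltnW mn] := leqP n m.
    have [] := dec n (m - n)%N; rewrite subnKC// => h _; have := pos m; lra.
  have [] := dec m (n - m)%N; rewrite subnKC// => _ h; have := pos n; lra.
pose A := [set y | exists n, y = u n - 2 * x / 2 ^+ n].
have A0 : A !=set0 by exists (u 0%N - 2 * x / 2 ^+ 0); exists 0%N.
have AU m : ubound A (u m + 2 * x / 2 ^+ m) by move=> y [n ->]; exact: ub.
exists (sup A) => n; rewrite ler_norml; apply/andP; split.
  suff : sup A <= u n + 2 * x / 2 ^+ n by lra.
  by apply: ge_sup.
suff : u n - 2 * x / 2 ^+ n <= sup A by lra.
apply: ub_le_sup; first by exists (u 0%N + 2 * x / 2 ^+ 0).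
by exists n.
Qed.

Lemma half_pow_lt e : 0 < e -> exists N, forall n, (N <= n)%N ->
  (2 ^+ n)^-1 <= e.
Proof.
move=> e0; pose N := Num.bound e^-1; exists N => n Nn.
have b : e^-1 < N%:R by apply: archi_boundP; rewrite invr_ge0 ltW.
rewrite -[leRHS]invrK lef_pV2 ?posrE ?invr_gt0 ?exprn_gt0//.
apply: (le_trans (ltW b)); apply: (@le_trans _ _ n%:R); first by rewrite ler_nat.
by rewrite -natrX ler_nat ltnW// ltn_expl.
Qed.

Lemma geom_cauchy (u : nat -> C) x :
  (forall n, cabs (u n.+1 - u n) <= x / 2 ^+ n) -> exists l, tends u l.
Proof.
move=> H.
have HR n : `|complex.Re (u n.+1) - complex.Re (u n)| <= x / 2 ^+ n.
  by apply: le_trans (H n); rewrite -ReN -ReD; exact: Re_le_cabs.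
have HI n : `|complex.Im (u n.+1) - complex.Im (u n)| <= x / 2 ^+ n.
  by apply: le_trans (H n); rewrite -ImN -ImD; exact: Im_le_cabs.
have [l1 H1] := real_geom_cauchy HR.
have [l2 H2] := real_geom_cauchy HI.
exists (l1 +i* l2) => e e0.
have x0 : 0 <= x.
  by have := H 0%N; rewrite expr0 divr1; apply: le_trans; exact: cabs_ge0.
have k0 : 0 < 4 * (x + 1) by lra.
have [N HN] := half_pow_lt (divr_gt0 e0 k0).
exists N => n /HN h; apply: le_trans (cabs_le_ReIm _) _.
have := H1 n; have := H2 n; rewrite ReD ReN ImD ImN /=.
rewrite ler_pdivlMr// in h.
set q := (2 ^+ n)^-1 in h *.
have : 0 < q by rewrite invr_gt0 exprn_gt0.
move=> *; nra.
Qed.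

(** Termwise differentiation, from a quadratic error bound that is uniform
    along the sequence. *)
Lemma has_deriv_lim (f : C -> C) (F : nat -> C -> C) (G : nat -> C)
    (a l : C) (d k : R) (N : nat) : 0 < d ->
  (forall h, cabs h < d -> tends (F^~ (a + h)) (f (a + h))) ->
  tends G l ->
  (forall n h, (N <= n)%N -> cabs h < d ->
     cabs (F n (a + h) - F n a - G n * h) <= k * cabs h ^+ 2) ->
  has_deriv f a l.
Proof.
move=> d0 Hf Hg H e e0.
have k0 : 0 < `|k| + 1 by rewrite ltr_wpDl.
exists (Num.min d (e / (`|k| + 1))); first by rewrite lt_min d0 divr_gt0.
move=> h; rewrite lt_min => /andP[hd]; rewrite ltr_pdivlMr// => he.
have t0 := Hf 0; rewrite cabs0 addr0 in t0.
have := tendsD (tendsD (Hf _ hd) (tendsZ (-1) (t0 d0))) (tendsZ (- h) Hg).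
move=> /(tends_le (N := N) (x := e * cabs h)).
rewrite mulN1r mulNr [h * l]mulrC; apply => n nN.
rewrite mulN1r mulNr [h * _]mulrC; apply: le_trans (H n h nN hd) _.
rewrite expr2 mulrA ler_wpM2r ?cabs_ge0//.
have := ler_norm k; have := cabs_ge0 h; nra.
Qed.

End Modulus.

(** * Power series with geometrically decaying coefficients *)
Section PowerSeries.
Variable R : realType.
Local Notation C := R[i].
Implicit Types (b : nat -> C) (s z h : C) (M x : R).

Definition partial_sum b s n : C := \sum_(k < n) b k * s ^+ k.

Definition power_series b s : C := xget 0 [set l | tends (partial_sum b s) l].

(** The ratio 3/10 is that of the sides of consecutive squares below.  With
    |s| <= 5/4 the terms of the series are at most M (3/8)^k, hence M / 2^k. *)
Definition geom_bounded M b := forall k, cabs (b k) <= M * (3 / 10) ^+ k.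

Lemma geom_bounded_ge0 M b : geom_bounded M b -> 0 <= M.
Proof. by move/(_ 0%N); rewrite expr0 mulr1; apply: le_trans; exact: cabs_ge0. Qed.

Lemma cabs_sum n (F : nat -> C) :
  cabs (\sum_(k < n) F k) <= \sum_(k < n) cabs (F k).
Proof.
elim: n => [|n IH]; first by rewrite !big_ord0 cabs0.
by rewrite !big_ord_recr /=; apply: le_trans (cabsD _ _) _; rewrite lerD2r.
Qed.

Lemma sum_half x n : 0 <= x -> \sum_(k < n) x / 2 ^+ k <= 2 * x.
Proof.
move=> x0; suff -> : \sum_(k < n) x / 2 ^+ k = 2 * x - 2 * x / 2 ^+ n.
  by rewrite lerBlDr lerDl mulr_ge0 ?mulr_ge0// invr_ge0 exprn_ge0.
elim: n => [|n IH]; first by rewrite big_ord0 expr0 divr1 subrr.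
by rewrite big_ord_recr /= IH exprS; field; rewrite gt_eqF// exprn_gt0.
Qed.

Lemma geom_bounded_term M b s n : geom_bounded M b -> cabs s <= 5 / 4 ->
  cabs (b n) * cabs s ^+ n <= M / 2 ^+ n.
Proof.
move=> bM s1; have M0 := geom_bounded_ge0 bM.
apply: (@le_trans _ _ (M * (3 / 10) ^+ n * (5 / 4) ^+ n)).
  by rewrite ler_pM ?cabs_ge0 ?exprn_ge0 ?cabs_ge0// lerXn2r ?nnegrE ?cabs_ge0//; lra.
rewrite -mulrA ler_wpM2l// -exprMn -exprVn lerXn2r ?nnegrE; lra.
Qed.

Lemma power_series_tends M b s : geom_bounded M b -> cabs s <= 5 / 4 ->
  tends (partial_sum b s) (power_series b s).
Proof.
move=> bM s1; rewrite /power_series; case: xgetP => [l _ //|].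
have [|l Hl] := @geom_cauchy R (partial_sum b s) M; last by move=> /(_ l) /(_ Hl).
move=> n; rewrite /partial_sum big_ord_recr /= addrAC subrr add0r cabsM cabsX.
exact: geom_bounded_term.
Qed.

Lemma power_seriesE b s l : tends (partial_sum b s) l -> power_series b s = l.
Proof.
move=> H; rewrite /power_series; case: xgetP => [m -> /tends_unique|/(_ l H)//].
by move=> /(_ _ H).
Qed.

Lemma power_series_rec M b s : geom_bounded M b -> cabs s <= 5 / 4 ->
  power_series b s = b 0%N + s * power_series (fun k => b k.+1) s.
Proof.
move=> bM s1; apply: power_seriesE; apply/tends_shift.
have bM' : geom_bounded (M * (3 / 10)) (fun k => b k.+1).
  by move=> k; rewrite -mulrA -exprS.
have := tendsD (tends_cst (b 0%N)) (tendsZ s (power_series_tends bM' s1)).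
apply: tends_eq => n; rewrite /partial_sum big_ord_recl /= expr0 mulr1; congr (_ + _).
by rewrite mulr_sumr; apply: eq_bigr => k _; rewrite exprS mulrCA.
Qed.

Lemma power_series_bound M b s : geom_bounded M b -> cabs s <= 5 / 4 ->
  cabs (power_series b s) <= 2 * M.
Proof.
move=> bM s1; apply: (tends_le (N := 0%N) (power_series_tends bM s1)) => n _.
apply: le_trans (cabs_sum n (fun k => b k * s ^+ k)) _.
apply: le_trans (sum_half n (geom_bounded_ge0 bM)).
by apply: ler_sum => k _; rewrite cabsM cabsX; exact: geom_bounded_term.
Qed.

Lemma bernoulli x n : 0 <= x -> n%:R * x <= (1 + x) ^+ n.
Proof.
move=> x0; suff : 1 + n%:R * x <= (1 + x) ^+ n by lra.
elim: n => [|n IH]; first by rewrite expr0 mul0r addr0.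
rewrite exprS -natr1; have : (0 : R) <= n%:R by [].
nra.
Qed.

(** The errors e n satisfy e (n+1) = (s + h) e n + n s^(n-1) h^2. *)
Lemma pow_taylor s h x n : 1 <= x -> cabs s <= x -> cabs (s + h) <= x ->
  cabs ((s + h) ^+ n - s ^+ n - n%:R * s ^+ n.-1 * h) <=
    n%:R ^+ 2 * x ^+ n * cabs h ^+ 2.
Proof.
move=> x1 sx shx; elim: n => [|n IH].
  by rewrite !expr0 subrr !mul0r subrr cabs0 expr0n /= !mul0r.
set e := _ - _ - _ in IH.
have -> : (s + h) ^+ n.+1 - s ^+ n.+1 - n.+1%:R * s ^+ n.+1.-1 * h =
  (s + h) * e + n%:R * s ^+ n.-1 * h ^+ 2.
  rewrite /e; case: n {IH e} => [|n]; first by rewrite !expr1 !expr0 /=; ring.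
  by rewrite /= !exprS -(natr1 n.+1); ring.
apply: le_trans (cabsD _ _) _; rewrite !cabsM !cabsX.
have -> : cabs (n%:R : C) = n%:R.
  by rewrite -(rmorph_nat (real_complex R)) cabs_real ger0_norm.
have xn : cabs s ^+ n.-1 <= x ^+ n.+1.
  apply: (@le_trans _ _ (x ^+ n.-1)).
    by rewrite lerXn2r ?nnegrE ?cabs_ge0//; lra.
  by rewrite ler_weXn2l// (leq_trans (leq_pred n)).
have h0 : 0 <= cabs h ^+ 2 by rewrite exprn_ge0// cabs_ge0.
have n0 : (0 : R) <= n%:R by [].
have t1 : cabs (s + h) * cabs e <= n%:R ^+ 2 * x ^+ n.+1 * cabs h ^+ 2.
  apply: (@le_trans _ _ (x * (n%:R ^+ 2 * x ^+ n * cabs h ^+ 2))).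
    by rewrite ler_pM ?cabs_ge0.
  by rewrite (exprS x) le_eqVlt; apply/orP; left; apply/eqP; ring.
have t2 : n%:R * cabs s ^+ n.-1 * cabs h ^+ 2 <= n%:R * x ^+ n.+1 * cabs h ^+ 2.
  by rewrite ler_wpM2r// ler_wpM2l.
apply: le_trans (lerD t1 t2) _.
rewrite -mulrDl ler_wpM2r// -mulrDl ler_wpM2r//; first by rewrite exprn_ge0//; lra.
rewrite -natr1; nra.
Qed.

(** Bernoulli's inequality for (8/7)^n gives n^2 <= 49 (64/49)^n, and
    64/49 * 3/4 < 1. *)
Lemma nat_sq_geom n : n%:R ^+ 2 * (3 / 8) ^+ n <= 49 / 2 ^+ n :> R.
Proof.
have -> : (3 / 8) ^+ n = (3 / 4) ^+ n / 2 ^+ n :> R.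
  by rewrite -exprVn -exprMn; congr (_ ^+ _); lra.
rewrite mulrA ler_wpM2r ?invr_ge0 ?exprn_ge0//.
have b := @bernoulli (1 / 7) n ltac:(lra).
have b2 : (n%:R * (1 / 7)) ^+ 2 <= ((1 + 1 / 7) ^+ n) ^+ 2 :> R.
  by rewrite lerXn2r ?nnegrE ?mulr_ge0 ?exprn_ge0//; lra.
have : ((1 + 1 / 7) ^+ n) ^+ 2 * (3 / 4) ^+ n <= 1 :> R.
  rewrite -exprM mulnC exprM -exprMn exprn_ile1//; lra.
have : 0 <= (3 / 4) ^+ n :> R by rewrite exprn_ge0//; lra.
rewrite exprMn in b2.
set y := _ ^+ n; move=> y0 b3.
have : n%:R ^+ 2 * (1 / 7) ^+ 2 * y <= 1 by nra.
rewrite expr2; lra.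
Qed.

(** Termwise differentiation; the Taylor errors of the monomials are summable
    because |s| <= 9/8 leaves a margin of 1/8 below 5/4. *)
Lemma power_series_deriv M b s : geom_bounded M b -> cabs s <= 9 / 8 ->
  exists l, has_deriv (power_series b) s l.
Proof.
move=> bM s1; have M0 := geom_bounded_ge0 bM.
have nC n : cabs (n%:R : C) = n%:R.
  by rewrite -(rmorph_nat (real_complex R)) cabs_real ger0_norm.
have B n : M * (3 / 10) ^+ n * (n%:R ^+ 2 * (5 / 4) ^+ n) <= 49 * M / 2 ^+ n.
  rewrite [49 * M]mulrC -[leRHS]mulrA.
  apply: le_trans (ler_wpM2l M0 (nat_sq_geom n)).
  have -> : (3 / 8) ^+ n = (3 / 10) ^+ n * (5 / 4) ^+ n :> R.
    by rewrite -exprMn; congr (_ ^+ _); lra.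
  by rewrite le_eqVlt; apply/orP; left; apply/eqP; ring.
pose G n := \sum_(k < n) b k * (k%:R * s ^+ k.-1).
have [|l Hl] := @geom_cauchy R G (49 * M).
  move=> n; rewrite /G big_ord_recr /= addrAC subrr add0r.
  apply: le_trans (B n); rewrite !cabsM cabsX nC.
  rewrite ler_pM ?mulr_ge0 ?exprn_ge0 ?cabs_ge0//.
  rewrite ler_pM ?exprn_ge0 ?cabs_ge0//.
    by rewrite -natrX ler_nat; case: n => // n; rewrite leq_pmulr.
  apply: (@le_trans _ _ ((5 / 4) ^+ n.-1)).
    by rewrite lerXn2r ?nnegrE ?cabs_ge0//; lra.
  by rewrite ler_weXn2l ?leq_pred//; lra.
exists l.
have d0 : (0 : R) < 1 / 8 by lra.
have sh h : cabs h < 1 / 8 -> cabs (s + h) <= 5 / 4.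
  by move=> hd; have := cabsD s h; lra.
apply: (has_deriv_lim (F := fun n z => partial_sum b z n) (k := 2 * (49 * M)) (N := 0%N)
  d0 _ Hl).
  by move=> h /sh; exact: power_series_tends.
move=> n h _ /sh hd.
rewrite /partial_sum /G mulr_suml -!sumrB.
apply: le_trans (cabs_sum _ (fun k => b k * (s + h) ^+ k - b k * s ^+ k -
  b k * (k%:R * s ^+ k.-1) * h)) _.
apply: (@le_trans _ _ (\sum_(k < n) 49 * M / 2 ^+ k * cabs h ^+ 2)); last first.
  rewrite -mulr_suml ler_wpM2r ?exprn_ge0 ?cabs_ge0//; apply: sum_half.
  by rewrite mulr_ge0.
apply: ler_sum => k _.
have -> : b k * (s + h) ^+ k - b k * s ^+ k - b k * (k%:R * s ^+ k.-1) * h =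
  b k * ((s + h) ^+ k - s ^+ k - k%:R * s ^+ k.-1 * h) by ring.
rewrite cabsM.
have x1 : (1 : R) <= 5 / 4 by lra.
have sx : cabs s <= 5 / 4 by lra.
have T := pow_taylor k x1 sx hd.
apply: (@le_trans _ _ ((M * (3 / 10) ^+ k) * (k%:R ^+ 2 * (5 / 4) ^+ k * cabs h ^+ 2))).
  by rewrite ler_pM ?cabs_ge0.
by rewrite mulrA ler_wpM2r ?exprn_ge0 ?cabs_ge0.
Qed.

End PowerSeries.

(** * Four-corner Cantor sets and the motion that rescales them *)
Section CantorSet.
Variable R : realType.
Local Notation C := R[i].
Implicit Types (l : nat -> R) (s z w : C) (m x y t : R).

Definition half_sign x : R := if 0 <= x then 1 / 2 else - (1 / 2).

(** The corner of the quadrant of z in the square of side 1 about 0.  Which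
    quadrant the axes are attached to is immaterial: the Cantor sets and the
    support of the motion stay away from them. *)
Definition corner z : C :=
  half_sign (complex.Re z) +i* half_sign (complex.Im z).

Definition tail l : nat -> R := fun k => l k.+1.

(** A square about 0 with unit of length l 0 has four children, centered at
    the points l 0 * p for the four corners p.  This is the position of z
    relative to the nearest of these centers. *)
Definition recenter l z : C := z - (l 0%N)%:C * corner z.

Fixpoint residual l z n : C :=
  if n is n'.+1 then residual (tail l) (recenter l z) n' else z.

(** A child of size 3/10 about a corner stays within 1/2 + 3/10 = 8/10 of the
    center of its parent and at distance 2/10 from the axes. *)
Definition admissible l := forall k, 0 < l k /\ l k.+1 <= 3 / 10 * l k.

(** The square hull of the Cantor set has half side at most
    1/2 + 1/2 * 3/10 + 1/2 * (3/10)^2 + ... = 5/7 in units of l 0, so every k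
    from 5/7 up to the radius 9/10 of the full squares describes the same set.
    The room between 3/4 and 4/5 absorbs the error terms of the motion. *)
Definition cantor (k : R) l : set C :=
  [set z | forall n, nrm (residual l z n) <= k * l n].

Definition cutoff m z : R := Num.min 1 (Num.max 0 (10 * (1 - nrm z / m))).

(** The identity on the square of radius 9/10 m, and 0 off the square of
    radius m. *)
Definition damp m z : C := (cutoff m z)%:C * z.

Definition drift_coef l z k : C := damp (l k) (residual l z k).

Definition drift s l z : C := power_series (drift_coef l z) s.

(** With z_k the position of z relative to the nearest center of level k, this
    is z + (s - 1) * (damp z_1 + s * damp z_2 + s^2 * damp z_3 + ...).  Summation by
    parts shows that a point deep in the construction, z = sum of l k * p_k, is
    sent to the sum of s^k * l k * p_k: every square is scaled by s inside its
    parent, while the motion remains a power series in s at every point. *)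
Definition flow s l z : C := z + (s - 1) * drift s (tail l) (recenter l z).

Lemma admissible_tail l : admissible l -> admissible (tail l).
Proof. by move=> gl k; exact: gl. Qed.

Lemma admissible_gt0 l k : admissible l ->
  0 < l k. Proof. by move=> /(_ k)[]. Qed.

Lemma admissible_geom l k : admissible l -> l k <= l 0%N * (3 / 10) ^+ k.
Proof.
move=> gl; elim: k => [|k IH]; first by rewrite expr0 mulr1.
by have [_ h] := gl k; rewrite exprS; lra.
Qed.

Lemma half_sign_cases x : half_sign x = 1 / 2 \/ half_sign x = - (1 / 2).
Proof. by rewrite /half_sign; case: ifP; [left|right]. Qed.

Lemma half_sign_far x y m t : 0 < m -> half_sign x <> half_sign y ->
  `|x - m * half_sign x| <= t ->
  m / 2 - t <= `|x - y|.
Proof.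
move=> m0; rewrite /half_sign; case: leP => x0; case: leP => y0 // _;
  rewrite !ler_norml => /andP[h1 h2];
  have [h|h] := leP 0 (x - y); rewrite ?(ger0_norm h) ?(ltr0_norm h); lra.
Qed.

Lemma nrm_corner z : nrm (corner z) = 1 / 2.
Proof.
have h : (0 : R) <= 1 / 2 by lra.
rewrite /nrm /=; case: (half_sign_cases (complex.Re z)) => ->;
  case: (half_sign_cases (complex.Im z)) => ->; by rewrite ?normrN ger0_norm// maxxx.
Qed.

Lemma ReCM x z : complex.Re (x%:C * z) = x * complex.Re z.
Proof. by rewrite ReM /= mul0r subr0. Qed.
Lemma ImCM x z : complex.Im (x%:C * z) = x * complex.Im z.
Proof. by rewrite ImM /= mul0r addr0. Qed.

Lemma corner_far z w m t : 0 < m -> corner z <> corner w ->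
  nrm (z - m%:C * corner z) <= t -> m / 2 - t <= nrm (z - w).
Proof.
move=> m0 ne; rewrite nrm_le ReD ImD ReN ImN ReCM ImCM => /andP[h1 h2].
have [e1|/eqP n1] := eqVneq (half_sign (complex.Re z)) (half_sign (complex.Re w)).
  have [e2|/eqP n2] := eqVneq (half_sign (complex.Im z)) (half_sign (complex.Im w)).
    by case: ne; rewrite /corner e1 e2.
  apply: le_trans (half_sign_far m0 n2 h2) _.
  by apply: le_trans (nrm_Im _); rewrite ImD ImN.
apply: le_trans (half_sign_far m0 n1 h1) _.
by apply: le_trans (nrm_Re _); rewrite ReD ReN.
Qed.

Lemma nrm_sub z w : nrm z - nrm w <= nrm (z - w).
Proof. by have := nrmD (z - w) w; rewrite subrK; lra. Qed.

Lemma nrm_distC z w : nrm (z - w) = nrm (w - z).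
Proof. by rewrite -nrmN opprB. Qed.

Lemma recenter_le l z : 0 < l 0%N -> nrm z - l 0%N / 2 <= nrm (recenter l z).
Proof.
move=> l0; apply: le_trans (nrm_sub _ _); rewrite nrm_real nrm_corner.
rewrite (gtr0_norm l0); lra.
Qed.

Lemma cutoff_ge0 m z : 0 <= cutoff m z.
Proof. by rewrite /cutoff le_min ler01 le_max lexx. Qed.
Lemma cutoff_le1 m z : cutoff m z <= 1.
Proof. by rewrite /cutoff ge_min lexx. Qed.

Lemma cutoff_out m z : 0 < m -> m <= nrm z -> cutoff m z = 0.
Proof.
move=> m0 mz; have h : 10 * (1 - nrm z / m) <= 0.
  have : 1 <= nrm z / m by rewrite ler_pdivlMr// mul1r.
  lra.
by rewrite /cutoff (max_idPl h) (min_idPr _).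
Qed.

Lemma cutoff_in m z : 0 < m -> nrm z <= 9 / 10 * m -> cutoff m z = 1.
Proof.
move=> m0 mz; have h : 1 <= 10 * (1 - nrm z / m).
  have : nrm z / m <= 9 / 10 by rewrite ler_pdivrMr.
  lra.
by rewrite /cutoff (min_idPl _)// le_max h orbT.
Qed.

Lemma damp_in m z : 0 < m -> nrm z <= 9 / 10 * m -> damp m z = z.
Proof. by move=> m0 /(cutoff_in m0) h; rewrite /damp h mul1r. Qed.
Lemma damp_out m z : 0 < m -> m <= nrm z -> damp m z = 0.
Proof. by move=> m0 /(cutoff_out m0) h; rewrite /damp h mul0r. Qed.

Lemma damp_bound m z : 0 < m -> nrm (damp m z) <= m.
Proof.
move=> m0; have [h|h] := leP m (nrm z).
  by rewrite damp_out// /nrm /= normr0 maxxx ltW.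
rewrite /damp nrm_real ger0_norm ?cutoff_ge0//.
apply: le_trans (ltW h); rewrite -[leRHS]mul1r.
by rewrite ler_wpM2r ?cutoff_le1// nrm_ge0.
Qed.

Lemma clamp_lipschitz x y :
  `|Num.min 1 (Num.max 0 x) - Num.min 1 (Num.max 0 y)| <= `|x - y|.
Proof.
have mx a b : `|Num.max 0 a - Num.max 0 b| <= `|a - b| :> R.
  have := ler_norm (a - b); have := ler_norm (b - a); rewrite distrC => h1 h2.
  by rewrite ler_norml; case: (leP 0 a) => ?; case: (leP 0 b) => ?; lra.
have mn a b : `|Num.min 1 a - Num.min 1 b| <= `|a - b| :> R.
  have := ler_norm (a - b); have := ler_norm (b - a); rewrite distrC => h1 h2.
  by rewrite ler_norml; case: (leP 1 a) => ?; case: (leP 1 b) => ?; lra.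
exact: le_trans (mn _ _) (mx _ _).
Qed.

Lemma cutoff_lipschitz m z w : 0 < m ->
  `|cutoff m z - cutoff m w| * m <= 10 * nrm (z - w).
Proof.
move=> m0; apply: (@le_trans _ _ (`|10 * (1 - nrm z / m) - 10 * (1 - nrm w / m)| * m)).
  by apply: ler_wpM2r; [exact: ltW|exact: clamp_lipschitz].
have -> : 10 * (1 - nrm z / m) - 10 * (1 - nrm w / m) = 10 * (nrm w - nrm z) / m.
  by field; rewrite gt_eqF.
rewrite normrM normfV (gtr0_norm m0) divfK ?gt_eqF// normrM ger0_norm//.
rewrite ler_wpM2l// ler_norml; apply/andP; split.
  by have := nrm_sub z w; lra.
by rewrite nrm_distC; exact: nrm_sub.
Qed.

Lemma damp_lipschitz m z w : 0 < m ->
  nrm (damp m z - damp m w) <= 11 * nrm (z - w).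
Proof.
move=> m0; have N0 := nrm_ge0 (z - w).
wlog : z w N0 / nrm w < m => [W|wm].
  have [h|h] := ltP (nrm w) m; first exact: W.
  have [k|k] := ltP (nrm z) m.
    by rewrite nrm_distC [nrm (z - w)]nrm_distC; apply: W; rewrite // nrm_distC.
  by rewrite !damp_out// subrr /nrm /= normr0 maxxx mulr_ge0.
have -> : damp m z - damp m w = (cutoff m z)%:C * (z - w) + (cutoff m z - cutoff m w)%:C * w.
  by rewrite /damp rmorphB; ring.
apply: le_trans (nrmD _ _) _; rewrite !nrm_real (ger0_norm (cutoff_ge0 _ _)).
have h1 : cutoff m z * nrm (z - w) <= nrm (z - w).
  by rewrite -[leRHS]mul1r ler_wpM2r ?cutoff_le1.
have h2 : `|cutoff m z - cutoff m w| * nrm w <= `|cutoff m z - cutoff m w| * m.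
  by rewrite ler_wpM2l// ltW.
have := cutoff_lipschitz z w m0; lra.
Qed.

Lemma drift_coef_geom l z : admissible l ->
  geom_bounded (2 * l 0%N) (drift_coef l z).
Proof.
move=> gl k; apply: le_trans (cabs_nrm _) _.
have := damp_bound (residual l z k) (admissible_gt0 k gl); have := admissible_geom k gl.
rewrite /drift_coef; lra.
Qed.

Lemma drift_rec l z s : admissible l -> cabs s <= 5 / 4 ->
  drift s l z = damp (l 0%N) z + s * drift s (tail l) (recenter l z).
Proof. by move=> gl s1; rewrite {1}/drift (power_series_rec (drift_coef_geom z gl)). Qed.

Lemma drift_bound l z s : admissible l -> cabs s <= 5 / 4 ->
  cabs (drift s l z) <= 4 * l 0%N.
Proof.
move=> gl s1; apply: le_trans (power_series_bound (drift_coef_geom z gl) s1) _; lra.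
Qed.

(** Once outside a square, a point is outside all its descendants. *)
Lemma residual_outside l z k : admissible l -> l 0%N <= nrm z ->
  l k <= nrm (residual l z k).
Proof.
elim: k l z => [//|k IH] l z gl lz /=; apply: (IH (tail l)).
  exact: admissible_tail.
have l0 := admissible_gt0 0 gl; have [_ h] := gl 0%N.
by have := recenter_le z l0; rewrite /tail; lra.
Qed.

Lemma drift_outside l z s : admissible l -> l 0%N <= nrm z -> drift s l z = 0.
Proof.
move=> gl lz; apply: power_seriesE; apply: tends_eq (tends_cst 0) => n.
rewrite /partial_sum big1// => k _; rewrite /drift_coef damp_out ?mul0r//; first exact: admissible_gt0.
exact: residual_outside.
Qed.

(** The children lie within 8/10 of the center, so that there is a moat up to
    the radius 9/10, where the deeper levels of the motion vanish and the
    current level is still affine. *)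
Lemma drift_far l z s : admissible l -> 8 / 10 * l 0%N <= nrm z ->
  drift s (tail l) (recenter l z) = 0.
Proof.
move=> gl lz; apply: drift_outside; first exact: admissible_tail.
have l0 := admissible_gt0 0 gl; have [_ h] := gl 0%N.
by have := recenter_le z l0; rewrite /tail; lra.
Qed.

(** Self-similarity: in a full child square the motion is an affine copy of
    the motion built from the remaining levels. *)
Lemma flow_in_child l z s : admissible l -> cabs s <= 5 / 4 ->
  nrm (recenter l z) <= 9 / 10 * l 1%N ->
  flow s l z = (l 0%N)%:C * corner z + s * flow s (tail l) (recenter l z).
Proof.
move=> gl s1 h; rewrite {1}/flow drift_rec//; last exact: admissible_tail.
have m0 := admissible_gt0 1 gl; rewrite damp_in//.
have e : z = (l 0%N)%:C * corner z + recenter l z by rewrite /recenter; ring.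
by rewrite /flow {1}e; ring.
Qed.

(** The deeper levels are not Lipschitz as functions on the plane, but they are
    supported within 8/10 of the centers of the children.  If two points are
    not in a common child square of radius 9/10 and one of them feels these
    levels, then the points are at least l 1 / 10 apart. *)
Lemma drift_lipschitz l z w s : admissible l -> cabs s <= 5 / 4 ->
  ~ (corner z = corner w /\ nrm (recenter l z) <= 9 / 10 * l 1%N
     /\ nrm (recenter l w) <= 9 / 10 * l 1%N) ->
  cabs (drift s (tail l) (recenter l z) - drift s (tail l) (recenter l w)) <=
    200 * nrm (z - w).
Proof.
move=> gl s1 nsc; have gl' := admissible_tail gl; have gl'' := admissible_tail gl'.
have l0 := admissible_gt0 0 gl; have [l1 l2] := gl 1%N; have [_ h01] := gl 0%N.
rewrite (drift_rec (recenter l z) gl' s1) (drift_rec (recenter l w) gl' s1).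
set z1 := recenter l z in nsc *; set w1 := recenter l w in nsc *.
set z2 := recenter _ z1; set w2 := recenter _ w1.
have N0 := nrm_ge0 (z - w).
pose m := l 1%N.
have m0 : 0 < m by [].
have eqd : corner z = corner w -> z1 - w1 = z - w.
  by rewrite /z1 /w1 /recenter => ->; ring.
(* The support of damp keeps clear of the axes, which gives the Lipschitz bound
   across quadrants as well. *)
have A : cabs (damp m z1 - damp m w1) <= 22 * nrm (z - w).
  apply: le_trans (cabs_nrm _) _.
  have [e|/eqP ne] := eqVneq (corner z) (corner w).
    by have := damp_lipschitz z1 w1 m0; rewrite (eqd e); lra.
  have bz : nrm (damp m z1) <= 2 * nrm (z - w).
    have [k|k] := leP m (nrm z1).
      by rewrite damp_out// {1}/nrm /= normr0 maxxx mulr_ge0.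
    have := damp_bound z1 m0; have := corner_far l0 ne (ltW k).
    rewrite /m in m0 *; lra.
  have bw : nrm (damp m w1) <= 2 * nrm (z - w).
    have [k|k] := leP m (nrm w1).
      by rewrite damp_out// {1}/nrm /= normr0 maxxx mulr_ge0.
    have := damp_bound w1 m0; have := corner_far l0 (not_eq_sym ne) (ltW k).
    rewrite (nrm_distC w); rewrite /m in m0 *; lra.
  have := nrmB (damp m z1) (damp m w1); lra.
(* Either the points are m / 10 apart or both deeper parts vanish. *)
have B : cabs (drift s (tail (tail l)) z2 - drift s (tail (tail l)) w2) <=
   100 * nrm (z - w).
  have gen (x y : C) : corner x = corner y /\ nrm (recenter l x) <= 9 / 10 * m
      /\ nrm (recenter l y) <= 9 / 10 * m \/
      (1 / 10 * m <= nrm (x - y)) \/ 8 / 10 * m <= nrm (recenter l x).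
    have [k|k] := leP (8 / 10 * m) (nrm (recenter l x)); first by right; right.
    have [e|/eqP ne] := eqVneq (corner x) (corner y); last first.
      right; left; have := corner_far l0 ne (ltW k); rewrite /m; lra.
    have [k'|k'] := leP (nrm (recenter l y)) (9 / 10 * m).
      by left; split => //; split => //; lra.
    right; left; have := nrm_sub (recenter l y) (recenter l x).
    have -> : recenter l y - recenter l x = y - x by rewrite /recenter e; ring.
    rewrite nrm_distC; lra.
  have bz := drift_bound z2 gl'' s1; have bw := drift_bound w2 gl'' s1.
  rewrite /tail in bz bw.
  have C1 := cabsB (drift s (tail (tail l)) z2) (drift s (tail (tail l)) w2).
  have done1 : 1 / 10 * m <= nrm (z - w) ->
    cabs (drift s (tail (tail l)) z2 - drift s (tail (tail l)) w2) <=
      100 * nrm (z - w).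
    rewrite /m; lra.
  have [//|[//|fz]] := gen z w.
  have [[e [a b]]|[d|fw]] := gen w z.
  - by case: nsc.
  - by apply: done1; rewrite nrm_distC.
  rewrite /z2 /w2 !drift_far// subrr cabs0; lra.
have -> : damp (tail l 0%N) z1 + s * drift s (tail (tail l)) z2 -
  (damp (tail l 0%N) w1 + s * drift s (tail (tail l)) w2) =
  (damp m z1 - damp m w1) + s * (drift s (tail (tail l)) z2 - drift s (tail (tail l)) w2).
  by rewrite /m /tail; ring.
apply: le_trans (cabsD _ _) _; rewrite cabsM.
have := cabs_ge0 (drift s (tail (tail l)) z2 - drift s (tail (tail l)) w2).
nra.
Qed.

(** Here |s - 1| times the Lipschitz constant 200 is at most 1/5. *)
Lemma flow_separates l z w s : admissible l -> cabs (s - 1) <= 1 / 1000 ->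
  ~ (corner z = corner w /\ nrm (recenter l z) <= 9 / 10 * l 1%N
     /\ nrm (recenter l w) <= 9 / 10 * l 1%N) ->
  flow s l z = flow s l w -> z = w.
Proof.
move=> gl s1 nsc E; have s5 : cabs s <= 5 / 4.
  have := cabsD (s - 1) 1; rewrite subrK cabs1; lra.
have := drift_lipschitz gl s5 nsc; move: E; rewrite /flow.
set p := drift _ _ _; set q := drift _ _ _ => E L.
have e : z - w = - ((s - 1) * (p - q)).
  transitivity ((z + (s - 1) * p) - (w + (s - 1) * q) - (s - 1) * (p - q)).
    by ring.
  by rewrite E subrr sub0r.
have c : cabs (z - w) <= 1 / 1000 * cabs (p - q).
  by rewrite e cabsN cabsM ler_wpM2r// cabs_ge0.
have := nrm_cabs (z - w); have := cabs_ge0 (z - w) => c0 c1.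
have : cabs (z - w) = 0 by lra.
by move=> /cabs_eq0/eqP; rewrite subr_eq0 => /eqP.
Qed.

(** Points with the same image are zoomed into a common child square as long
    as they have one; when they have none, [flow_separates] applies. *)
Lemma flow_injective_upto l z w s n : admissible l ->
  cabs (s - 1) <= 1 / 1000 ->
  flow s l z = flow s l w -> z = w \/ nrm (z - w) <= 2 * l n.+1.
Proof.
move=> gl s1; have s5 : cabs s <= 5 / 4.
  have := cabsD (s - 1) 1; rewrite subrK cabs1; lra.
elim: n l z w gl => [|n IH] l z w gl E.
  have [[ec [a b]]|nsc] := pselect (corner z = corner w /\
    nrm (recenter l z) <= 9 / 10 * l 1%N /\ nrm (recenter l w) <= 9 / 10 * l 1%N); last first.
    by left; exact: flow_separates E.
  right; have -> : z - w = recenter l z - recenter l w by rewrite /recenter ec; ring.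
  by have := nrmB (recenter l z) (recenter l w); have := admissible_gt0 1 gl; lra.
have [[ec [a b]]|nsc] := pselect (corner z = corner w /\
  nrm (recenter l z) <= 9 / 10 * l 1%N /\ nrm (recenter l w) <= 9 / 10 * l 1%N); last first.
  by left; exact: flow_separates E.
have d : recenter l z - recenter l w = z - w by rewrite /recenter ec; ring.
have : flow s (tail l) (recenter l z) = flow s (tail l) (recenter l w).
  move: E; rewrite (flow_in_child gl s5 a) (flow_in_child gl s5 b) ec => /addrI; apply: mulfI.
  apply/eqP => s0; move: s1; rewrite s0 sub0r cabsN cabs1; lra.
move/(IH _ _ _ (admissible_tail gl)); rewrite d => -[/eqP|]; last by right.
by rewrite -subr_eq0 d subr_eq0 => /eqP; left.
Qed.

Lemma pow_small (q : R) x : 0 < x -> q <= 1 / 2 -> 0 <= q ->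
  exists N, forall n, (N <= n)%N -> q ^+ n <= x.
Proof.
move=> x0 q2 q0; have [N HN] := half_pow_lt x0; exists N => n /HN.
apply: le_trans; rewrite -exprVn lerXn2r ?nnegrE//; lra.
Qed.

Lemma admissible_small l x : admissible l -> 0 < x ->
  exists N, forall n, (N <= n)%N -> l n <= x.
Proof.
move=> gl x0; have l0 := admissible_gt0 0 gl.
have [N HN] := @pow_small (3 / 10) (x / l 0%N) (divr_gt0 x0 l0) ltac:(lra) ltac:(lra).
exists N => n /HN h; apply: le_trans (admissible_geom n gl) _.
by rewrite mulrC -ler_pdivlMr.
Qed.

Lemma flow_injective l z w s : admissible l -> cabs (s - 1) <= 1 / 1000 ->
  flow s l z = flow s l w -> z = w.
Proof.
move=> gl s1 E; apply: contrapT => ne.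
have n0 : 0 < nrm (z - w).
  rewrite lt_neqAle nrm_ge0 andbT eq_sym; apply/eqP => n0; apply: ne.
  apply/eqP; rewrite -subr_eq0; apply/eqP/cabs_eq0/eqP.
  by rewrite eq_le cabs_ge0 andbT; have := cabs_nrm (z - w); rewrite n0 mulr0.
have x0 : 0 < nrm (z - w) / 4 by lra.
have [N HN] := admissible_small gl x0.
have [//|] := flow_injective_upto N gl s1 E; have := HN N.+1 (leqnSn N); lra.
Qed.

End CantorSet.

(** * Images of the Cantor set for real parameters *)
Section RealParameter.
Variable R : realType.
Local Notation C := R[i].
Implicit Types (l : nat -> R) (z w : C) (m x y t s : R).

Lemma half_sign_stable x y m : 0 < m -> `|y| < m / 2 ->
  half_sign (m * half_sign x + y) = half_sign x.
Proof.
move=> m0; rewrite ltr_norml => /andP[h1 h2].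
rewrite {1}/half_sign; case: (half_sign_cases x) => ->; case: leP => // h; lra.
Qed.

Lemma half_sign_pos x t : 0 < t -> half_sign (t * x) = half_sign x.
Proof. by move=> t0; rewrite /half_sign pmulr_rge0. Qed.

Lemma corner_stable z w m : 0 < m -> nrm w < m / 2 ->
  corner (m%:C * corner z + w) = corner z.
Proof.
move=> m0; rewrite nrm_lt => /andP[h1 h2].
by rewrite {1}/corner ReD ImD ReCM ImCM /= !half_sign_stable.
Qed.

Lemma corner_pos z t : 0 < t -> corner (t%:C * z) = corner z.
Proof. by move=> t0; rewrite /corner ReCM ImCM !half_sign_pos. Qed.

Lemma real_param s : 1 - 1 / 1000 <= s <= 1 ->
  cabs (s%:C - 1) <= 1 / 1000 /\ cabs s%:C <= 5 / 4.
Proof.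
move=> /andP[h1 h2].
have -> : (s%:C : C) - 1 = (s - 1)%:C by rewrite rmorphB.
by rewrite !cabs_real !ler_norml; split; apply/andP; split; lra.
Qed.

Lemma flow_size l z s : admissible l -> 1 - 1 / 1000 <= s <= 1 ->
  nrm z <= 3 / 4 * l 0%N -> nrm (flow s%:C l z) <= 4 / 5 * l 0%N.
Proof.
move=> gl /real_param[s1 s5] hz; rewrite /flow.
apply: le_trans (nrmD _ _) _.
have h := nrm_cabs ((s%:C - 1) * drift s%:C (tail l) (recenter l z)).
rewrite cabsM in h.
have b := drift_bound (recenter l z) (admissible_tail gl) s5.
have [l0 l1] := gl 0%N; have l2 := admissible_gt0 1 gl; rewrite /tail in b h.
set p := cabs (drift _ _ _) in b h.
have : cabs (s%:C - 1) * p <= 1 / 1000 * (4 * l 1%N) by rewrite ler_pM ?cabs_ge0.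
lra.
Qed.

(** For a real parameter the image of a point keeps the same itinerary, with
    l n replaced by s^n * l n.  The factor t carries the scaling accumulated
    through the levels already passed. *)
Lemma flow_residual l z s t n : admissible l -> 1 - 1 / 1000 <= s <= 1 ->
  0 < t ->
  cantor (3 / 4) l z ->
  nrm (residual (fun k => t * s ^+ k * l k) (t%:C * flow s%:C l z) n)
    <= 4 / 5 * (t * s ^+ n * l n).
Proof.
move=> gl s1 t0; elim: n l z t t0 gl => [|n IH] l z t t0 gl lz.
  rewrite /= expr0 mulr1 nrm_real gtr0_norm// mulrCA ler_pM2l//.
  by apply: flow_size => //; exact: (lz 0%N).
have [sa sb] := andP s1; have s0 : 0 < s by lra.
have [_ s5] := real_param s1.
have lz1 : cantor (3 / 4) (tail l) (recenter l z) by move=> k; exact: (lz k.+1).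
have h1 : nrm (recenter l z) <= 3 / 4 * l 1%N by exact: (lz 1%N).
have [l0 l1] := gl 0%N; have l2 := admissible_gt0 1 gl.
have b := flow_size (admissible_tail gl) s1 h1; rewrite /tail in b.
have Hi : flow s%:C l z = (l 0%N)%:C * corner z + s%:C * flow s%:C (tail l) (recenter l z).
  apply: flow_in_child => //; lra.
have c : corner (t%:C * flow s%:C l z) = corner z.
  rewrite corner_pos// Hi corner_stable// nrm_real gtr0_norm//.
  set y := nrm _ in b *; have : s * y <= 1 * y by rewrite ler_wpM2r ?nrm_ge0.
  lra.
have -> : t * s ^+ n.+1 * l n.+1 = (t * s) * s ^+ n * tail l n.
  by rewrite exprS /tail; ring.
rewrite [residual _ _ _]/(residual _ (recenter _ _) n).
have -> : tail (fun k => t * s ^+ k * l k) = fun k => (t * s) * s ^+ k * tail l k.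
  by apply/funext => k; rewrite /tail exprS; ring.
have -> : recenter (fun k => t * s ^+ k * l k) (t%:C * flow s%:C l z) =
    (t * s)%:C * flow s%:C (tail l) (recenter l z).
  by rewrite {1}/recenter c Hi expr0 mulr1 !rmorphM /=; ring.
by apply: IH => //; [exact: mulr_gt0|exact: admissible_tail].
Qed.

Definition rescale s l : nat -> R := fun k => s ^+ k * l k.

Lemma admissible_rescale s l : admissible l -> 0 < s <= 1 ->
  admissible (rescale s l).
Proof.
move=> gl /andP[s0 s1] k; have [h1 h2] := gl k; rewrite /rescale exprS.
have sk : 0 < s ^+ k by rewrite exprn_gt0.
split; first by rewrite mulr_gt0.
rewrite -mulrA mulrCA [leRHS]mulrCA; apply: ler_wpM2l; first exact: ltW.
have := admissible_gt0 k.+1 gl; nra.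
Qed.

Lemma flow_cantor l z s : admissible l -> 1 - 1 / 1000 <= s <= 1 ->
  cantor (3 / 4) l z -> cantor (4 / 5) (rescale s l) (flow s%:C l z).
Proof.
move=> gl s1 lz n; have := @flow_residual l z s 1 n gl s1 ltr01 lz.
rewrite !mul1r.
by under [X in residual X]funext do rewrite mul1r.
Qed.

(** The total length 4^n * side n = (n + 12)^2 has summable inverses but grows
    slower than any exponential.  The offset 12 keeps the ratios
    1/4 * ((n + 13) / (n + 12))^2 below 3/10. *)
Definition side : nat -> R := fun n => (n%:R + 12) ^+ 2 / 4 ^+ n.

Lemma side_admissible : admissible side.
Proof.
move=> n; have n0 : (0 : R) <= n%:R by [].
have p4 : (0 : R) < 4 ^+ n by rewrite exprn_gt0.
split; first by rewrite divr_gt0// exprn_gt0; lra.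
rewrite /side (exprS 4) -natr1 ler_pdivrMr; last by rewrite mulr_gt0.
have -> : 3 / 10 * ((n%:R + 12) ^+ 2 / 4 ^+ n) * (4 * 4 ^+ n) = 12 / 10 * (n%:R + 12) ^+ 2 :> R.
  by field; rewrite gt_eqF.
rewrite !expr2; nra.
Qed.

(** Telescoping: 1 / (n + 12)^2 <= 1 / (n + 11) - 1 / (n + 12). *)
Lemma side_sum n : \sum_(k < n) (1 / 4) ^+ k * (3 / side k) <= 3 / 11.
Proof.
suff : \sum_(k < n) (1 / 4) ^+ k * (3 / side k) <= 3 / 11 - 3 / (n%:R + 11).
  have : (0 : R) <= 3 / (n%:R + 11) by rewrite divr_ge0//; have : (0:R) <= n%:R by []; lra.
  lra.
elim: n => [|n IH]; first by rewrite big_ord0 add0r subrr.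
rewrite big_ord_recr /=; apply: le_trans (lerD IH (lexx _)) _.
have n0 : (0 : R) <= n%:R by [].
have p4 : (0 : R) < 4 ^+ n by rewrite exprn_gt0.
have -> : (1 / 4) ^+ n * (3 / side n) = 3 / (n%:R + 12) ^+ 2 :> R.
  rewrite /side expr_div_n expr1n; field; rewrite gt_eqF//= gt_eqF//; lra.
rewrite -(natr1 n).
have -> : n%:R + 1 + 11 = n%:R + 12 :> R by ring.
have -> : 3 / 11 - 3 / (n%:R + 12) = 3 / 11 - 3 / (n%:R + 11) +
   3 / ((n%:R + 11) * (n%:R + 12)) :> R.
  by field; rewrite !gt_eqF//; lra.
have a1 : (0 : R) < n%:R + 11 by lra.
have a2 : (0 : R) < n%:R + 12 by lra.
rewrite lerD2l expr2 ler_pM2l// lef_pV2 ?posrE ?mulr_gt0//; nra.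
Qed.

Lemma side_length_vanishes s x : 0 < s < 1 -> 0 < x ->
  exists n, 4 ^+ n * rescale s side n <= x.
Proof.
move=> /andP[s0 s1] x0.
suff [n Hn] : exists n, (n%:R + 12) ^+ 2 * s ^+ n <= x.
  exists n; rewrite /rescale /side.
  have p4 : (0 : R) < 4 ^+ n by rewrite exprn_gt0.
  suff -> : 4 ^+ n * (s ^+ n * ((n%:R + 12) ^+ 2 / 4 ^+ n)) = (n%:R + 12) ^+ 2 * s ^+ n by [].
  by field; rewrite gt_eqF.
(* With (1 + y)^3 <= s^-1, Bernoulli's inequality bounds s^-n below by (n y)^3,
   which beats the square. *)
pose y := Num.min 1 ((s^-1 - 1) / 8).
have si : 1 < s^-1 by rewrite invf_gt1.
have y0 : 0 < y by rewrite /y lt_min ltr01 divr_gt0//; lra.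
have y1 : y <= 1 by rewrite /y ge_min lexx.
have y2 : y <= (s^-1 - 1) / 8 by rewrite /y ge_min lexx orbT.
have q3 : (1 + y) ^+ 3 <= s^-1.
  rewrite !exprS expr0; nra.
have k0 : 0 < x * y ^+ 3 by rewrite mulr_gt0// exprn_gt0.
pose n := (Num.bound (169 / (x * y ^+ 3))).+1.
have nb : 169 / (x * y ^+ 3) < n%:R.
  apply: lt_trans (archi_boundP _) _; first by rewrite divr_ge0// ltW.
  by rewrite ltr_nat.
have n1 : (1 : R) <= n%:R by rewrite ler1n.
exists n; have sn : s ^+ n = (s^-1 ^+ n)^-1 by rewrite exprVn invrK.
rewrite sn ler_pdivrMr ?exprn_gt0 ?invr_gt0//.
have b := @bernoulli R y n (ltW y0).
have b3 : (n%:R * y) ^+ 3 <= s^-1 ^+ n.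
  apply: (@le_trans _ _ (((1 + y) ^+ n) ^+ 3)).
    by rewrite lerXn2r ?nnegrE ?exprn_ge0 ?mulr_ge0//; lra.
  by rewrite -exprM mulnC exprM lerXn2r ?nnegrE ?exprn_ge0 ?invr_ge0//; lra.
apply: (@le_trans _ _ (x * (n%:R * y) ^+ 3)); last by rewrite ler_wpM2l// ltW.
rewrite exprMn.
have h169 : 169 <= x * y ^+ 3 * n%:R.
  by move/ltW: nb; rewrite ler_pdivrMr// mulrC.
have -> : x * (n%:R ^+ 3 * y ^+ 3) = x * y ^+ 3 * n%:R * n%:R ^+ 2 by ring.
apply: (@le_trans _ _ (169 * n%:R ^+ 2)); last by rewrite ler_wpM2r ?exprn_ge0.
rewrite !expr2; nra.
Qed.

End RealParameter.

(** * The Cauchy transform of the uniform measure *)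
Section CauchyTransform.
Variable R : realType.
Local Notation C := R[i].
Implicit Types (l : nat -> R) (z w c u h p : C) (m x y t d M : R) (F G : C -> C).

Fixpoint is_center l n c : Prop :=
  if n is n'.+1 then
    exists2 p, corner p = p & is_center (tail l) n' (c - (l 0%N)%:C * p)
  else c = 0.

Definition corner_mean (f : C -> C) : C :=
  (1 / 4)%:C * (f ((1 / 2) +i* (1 / 2)) + f ((1 / 2) +i* (- (1 / 2))) +
   f ((- (1 / 2)) +i* (1 / 2)) + f ((- (1 / 2)) +i* (- (1 / 2)))).

(** The integral of F (z - c) against the uniform probability measure on the
    4^n centers c of level n. *)
Fixpoint center_mean l n F z : C :=
  if n is n'.+1 then corner_mean (fun p => center_mean (tail l) n' F (z - (l 0%N)%:C * p))
  else F z.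

Lemma half_signK x : half_sign (half_sign x) = half_sign x.
Proof. by rewrite {1}/half_sign; case: (half_sign_cases x) => ->; case: leP => // h; lra. Qed.

Lemma cornerK z : corner (corner z) = corner z.
Proof. by rewrite /corner /= !half_signK. Qed.

Lemma half_sign_half : half_sign (1 / 2 : R) = 1 / 2.
Proof. by rewrite /half_sign; case: leP => // h; lra. Qed.
Lemma half_sign_mhalf : half_sign (- (1 / 2) : R) = - (1 / 2).
Proof. by rewrite /half_sign; case: leP => // h; lra. Qed.

Lemma quarter : cabs (1 / 4)%:C = 1 / 4 :> R.
Proof. by rewrite cabs_real ger0_norm//; lra. Qed.

Lemma corner_mean_bound f M : (forall p, corner p = p -> cabs (f p) <= M) ->
  cabs (corner_mean f) <= M.
Proof.
move=> H; rewrite /corner_mean cabsM quarter.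
have h1 := H ((1 / 2) +i* (1 / 2)); have h2 := H ((1 / 2) +i* (- (1 / 2))).
have h3 := H ((- (1 / 2)) +i* (1 / 2)); have h4 := H ((- (1 / 2)) +i* (- (1 / 2))).
move: h1 h2 h3 h4; rewrite /corner /= !half_sign_half !half_sign_mhalf.
move=> /(_ erefl) h1 /(_ erefl) h2 /(_ erefl) h3 /(_ erefl) h4.
set a := f _ in h1 *; set b := f _ in h2 *; set c := f _ in h3 *.
set d := f _ in h4 *.
have := cabsD (a + b + c) d; have := cabsD (a + b) c; have := cabsD a b; lra.
Qed.

(** Separates the corner q of the quadrant of the pole, where f may be large. *)
Lemma corner_mean_bound_near f M N q : corner q = q -> cabs (f q) <= M ->
  (forall p, corner p = p -> p <> q -> cabs (f p) <= N) ->
  cabs (corner_mean f) <= 1 / 4 * M + 3 / 4 * N.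
Proof.
move=> Hq hq H; rewrite /corner_mean cabsM quarter.
set a := f _; set b := f _; set c := f _; set d := f _.
have := cabsD (a + b + c) d; have := cabsD (a + b) c; have := cabsD a b.
suff : cabs a + cabs b + cabs c + cabs d <= M + 3 * N by lra.
have hn : 1 / 2 <> - (1 / 2) :> R.
  by move=> e; clear -e; lra.
have cn (x y x' y' : R) : x <> x' \/ y <> y' -> x +i* y <> x' +i* y'.
  by move=> [] k [].
rewrite /a /b /c /d; move: Hq hq H; rewrite /corner.
case: q => q1 q2 /= [<- <-].
case: (half_sign_cases q1) => ->; case: (half_sign_cases q2) => -> hq H.
- have h2 := H ((1 / 2) +i* (- (1 / 2))).
  have h3 := H ((- (1 / 2)) +i* (1 / 2)).
  have h4 := H ((- (1 / 2)) +i* (- (1 / 2))).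
  move: h2 h3 h4; rewrite /= !half_sign_half !half_sign_mhalf.
  move=> /(_ erefl) h2 /(_ erefl) h3 /(_ erefl) h4.
  have {}h2 := h2 (cn _ _ _ _ (or_intror (not_eq_sym hn))).
  have {}h3 := h3 (cn _ _ _ _ (or_introl (not_eq_sym hn))).
  have {}h4 := h4 (cn _ _ _ _ (or_introl (not_eq_sym hn))).
  lra.
- have h2 := H ((1 / 2) +i* (1 / 2)).
  have h3 := H ((- (1 / 2)) +i* (1 / 2)).
  have h4 := H ((- (1 / 2)) +i* (- (1 / 2))).
  move: h2 h3 h4; rewrite /= !half_sign_half !half_sign_mhalf.
  move=> /(_ erefl) h2 /(_ erefl) h3 /(_ erefl) h4.
  have {}h2 := h2 (cn _ _ _ _ (or_intror hn)).
  have {}h3 := h3 (cn _ _ _ _ (or_introl (not_eq_sym hn))).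
  have {}h4 := h4 (cn _ _ _ _ (or_introl (not_eq_sym hn))).
  lra.
- have h2 := H ((1 / 2) +i* (1 / 2)).
  have h3 := H ((1 / 2) +i* (- (1 / 2))).
  have h4 := H ((- (1 / 2)) +i* (- (1 / 2))).
  move: h2 h3 h4; rewrite /= !half_sign_half !half_sign_mhalf.
  move=> /(_ erefl) h2 /(_ erefl) h3 /(_ erefl) h4.
  have {}h2 := h2 (cn _ _ _ _ (or_introl hn)).
  have {}h3 := h3 (cn _ _ _ _ (or_introl hn)).
  have {}h4 := h4 (cn _ _ _ _ (or_intror (not_eq_sym hn))).
  lra.
- have h2 := H ((1 / 2) +i* (1 / 2)).
  have h3 := H ((1 / 2) +i* (- (1 / 2))).
  have h4 := H ((- (1 / 2)) +i* (1 / 2)).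
  move: h2 h3 h4; rewrite /= !half_sign_half !half_sign_mhalf.
  move=> /(_ erefl) h2 /(_ erefl) h3 /(_ erefl) h4.
  have {}h2 := h2 (cn _ _ _ _ (or_introl hn)).
  have {}h3 := h3 (cn _ _ _ _ (or_introl hn)).
  have {}h4 := h4 (cn _ _ _ _ (or_intror hn)).
  lra.
Qed.

Lemma corner_mean_cst c : corner_mean (fun=> c) = c.
Proof.
rewrite /corner_mean; have -> : c + c + c + c = 4%:R * c by ring.
rewrite mulrA -(rmorph_nat (real_complex R)) -rmorphM.
have -> : 1 / 4 * 4%:R = 1 :> R by lra.
by rewrite rmorph1 mul1r.
Qed.

Lemma center_mean_bound l n F z M :
  (forall c, is_center l n c -> cabs (F (z - c)) <= M) -> cabs (center_mean l n F z) <= M.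
Proof.
elim: n l z => [|n IH] l z H /=.
  by have := H 0 erefl; rewrite subr0.
apply: corner_mean_bound => p cp; apply: IH => c hc.
rewrite -addrA -opprD; apply: H; exists p => //.
by rewrite addrC addKr.
Qed.

Lemma center_mean_lin l n F G a b z :
  center_mean l n (fun u => a * F u + b * G u) z = a * center_mean l n F z + b * center_mean l n G z.
Proof. by elim: n l z => [//|n IH] l z /=; rewrite /corner_mean !IH; ring. Qed.

Lemma center_mean_cst l n c z : center_mean l n (fun=> c) z = c.
Proof.
elim: n l z => [//|n IH] l z /=; rewrite -[RHS]corner_mean_cst; congr corner_mean.
by apply/funext.
Qed.

Lemma center_mean_translate l n F z h :
  center_mean l n F (z + h) = center_mean l n (fun u => F (u + h)) z.
Proof.
elim: n l z => [//|n IH] l z /=; congr corner_mean; apply/funext => p.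
by rewrite -IH addrAC.
Qed.

(** The recursion of [center_mean] peels the coarsest level; refining by one
    level acts at the finest. *)
Lemma center_mean_succ l n F z : center_mean l n.+1 F z =
  center_mean l n (fun u => corner_mean (fun p => F (u - (l n)%:C * p))) z.
Proof.
elim: n l z => [//|n IH] l z.
exact: (congr1 corner_mean (funext (fun p => IH (tail l) (z - (l 0%N)%:C * p)))).
Qed.

Lemma is_center_bound l n c : admissible l -> is_center l n c ->
  nrm c <= 5 / 7 * l 0%N.
Proof.
elim: n l c => [|n IH] l c gl /=.
  move=> ->; rewrite /nrm /= normr0 maxxx; have := admissible_gt0 0 gl; lra.
move=> [p cp /(IH _ _ (admissible_tail gl))]; rewrite /tail => h.
have -> : c = (c - (l 0%N)%:C * p) + (l 0%N)%:C * p by ring.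
have [l0 l1] := gl 0%N.
apply: le_trans (nrmD _ _) _; rewrite nrm_real -cp nrm_corner gtr0_norm// cp.
lra.
Qed.

Lemma is_center_residual l n z : is_center l n (z - residual l z n).
Proof.
elim: n l z => [|n IH] l z /=; first by rewrite subrr.
exists (corner z); first exact: cornerK.
have -> : z - residual (tail l) (recenter l z) n - (l 0%N)%:C * corner z =
  recenter l z - residual (tail l) (recenter l z) n by rewrite /recenter; ring.
exact: IH.
Qed.

(** A wrong corner is l 0 / 2 away across an axis, and the descendants of the
    child at that corner spread by at most 5/7 * 3/10 * l 0 = 3/14 * l 0. *)
Lemma other_child_far l n c p z : admissible l -> corner p = p ->
  p <> corner z ->
  is_center (tail l) n c -> 2 / 7 * l 0%N <= nrm (z - (l 0%N)%:C * p - c).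
Proof.
move=> gl cp pz hc; have := is_center_bound (admissible_tail gl) hc; rewrite /tail.
have [l0 l1] := gl 0%N => h.
have k : corner ((l 0%N)%:C * p + c) = p.
  by rewrite -cp corner_stable ?cp//; lra.
have := @corner_far R ((l 0%N)%:C * p + c) z (l 0%N) (5 / 7 * l 1%N) l0.
rewrite k => /(_ pz); rewrite addrC addKr => /(_ h).
rewrite nrm_distC opprD addrA => h'; lra.
Qed.

(** Only the levels from N on matter: a point off the Cantor set may well be
    a center of low level. *)
Definition away l z d N := forall n c, (N <= n)%N -> is_center l n c ->
  d <= nrm (z - c).

Lemma away_outside l z N : admissible l -> 3 / 4 * l N < nrm (residual l z N) ->
  away l z (1 / 28 * l N) N.
Proof.
elim: N l z => [|N IH] l z gl h n c.
  by move=> _ /(is_center_bound gl) hc; have := nrm_sub z c; rewrite /= in h; lra.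
case: n => // n; rewrite ltnS => Nn /= [p cp hc].
have [e|/eqP ne] := eqVneq p (corner z).
  have -> : z - c = recenter l z - (c - (l 0%N)%:C * p) by rewrite e /recenter; ring.
  exact: IH (admissible_tail gl) h _ _ Nn hc.
have -> : z - c = z - (l 0%N)%:C * p - (c - (l 0%N)%:C * p) by ring.
apply: le_trans (other_child_far gl cp ne hc).
have := admissible_geom N.+1 gl; have l0 := admissible_gt0 0 gl.
have : (3 / 10) ^+ N.+1 <= 1 :> R by rewrite exprn_ile1//; lra.
move=> *; nra.
Qed.

Lemma away_nearby l z h d N : away l z d N -> nrm h <= d / 2 ->
  away l (z + h) (d / 2) N.
Proof.
move=> H hd n c Nn hc; have := H n c Nn hc.
have -> : z - c = (z + h - c) - h by ring.
have := nrmB (z + h - c) h; lra.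
Qed.

Lemma away_of_not_cantor l z : admissible l -> ~ cantor (3 / 4) l z ->
  exists2 d : R, 0 < d & exists N, away l z d N.
Proof.
move=> gl /existsNP[N /negP]; rewrite -ltNge => h.
exists (1 / 28 * l N); last by exists N; exact: away_outside.
have := admissible_gt0 N gl; lra.
Qed.

(** Three quarters of the mass sit in children that do not face z, at distance
    at least 2/7 * l 0; the last quarter is handled by recursion.  The k-th
    level thus contributes a multiple of 4^-k / l k. *)
Lemma center_mean_inv_bound l n z : admissible l ->
  cabs (center_mean l n (fun u => u^-1) z) <=
    \sum_(k < n) (1 / 4) ^+ k * (3 / l k) + (1 / 4) ^+ n / cabs (residual l z n).
Proof.
elim: n l z => [|n IH] l z gl /=.
  by rewrite big_ord0 add0r expr0 cabsV mul1r.
have l0 := admissible_gt0 0 gl.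
apply: le_trans (corner_mean_bound_near (cornerK z) (IH _ (recenter l z) (admissible_tail gl)) _) _.
  move=> p cp pz; apply: (center_mean_bound (M := 7 / 2 / l 0%N)) => c hc.
  have h := other_child_far gl cp pz hc; rewrite cabsV.
  set y := _ - c in h *; have h' := nrm_cabs y.
  have -> : 7 / 2 / l 0%N = (2 / 7 * l 0%N)^-1 by field; rewrite gt_eqF.
  by rewrite lef_pV2 ?posrE; lra.
have -> : \sum_(k < n.+1) (1 / 4) ^+ k * (3 / l k) =
  3 / l 0%N + 1 / 4 * \sum_(k < n) (1 / 4) ^+ k * (3 / tail l k).
  rewrite big_ord_recl expr0 mul1r mulr_sumr; congr (_ + _).
  by apply: eq_bigr => k _; rewrite lift0 exprS -mulrA.
rewrite exprS.
set S := \sum_(k < n) _; set r := cabs _.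
have : 3 / 4 * (7 / 2 / l 0%N) <= 3 / l 0%N.
  have -> : 3 / 4 * (7 / 2 / l 0%N) = 21 / 8 / l 0%N by field; rewrite gt_eqF.
  by rewrite ler_pM2r ?invr_gt0//; lra.
rewrite -(mulrA (1 / 4)); lra.
Qed.

Lemma geom_cauchy_from (u : nat -> C) x N :
  (forall n, (N <= n)%N -> cabs (u n.+1 - u n) <= x / 2 ^+ n) ->
  exists v, tends u v.
Proof.
move=> H.
(* Constant up to N, so that the bound holds from the start. *)
pose u' n := if (n < N)%N then u N else u n.
have [|v Hv] := @geom_cauchy R u' `|x|.
  move=> n; rewrite /u'; have [Nn|nN] := leqP N n.
    rewrite ltnNge (leq_trans Nn)//=; apply: le_trans (H _ Nn) _.
    by rewrite ler_wpM2r ?invr_ge0 ?exprn_ge0// ler_norm.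
  have -> : (if (n.+1 < N)%N then u N else u n.+1) = u N.
    by case: ifP => // /negbT; rewrite -leqNgt => h; congr u; apply: anti_leq; rewrite nN.
  by rewrite subrr cabs0 divr_ge0// exprn_ge0.
exists v => e e0; have [M HM] := Hv e e0; exists (maxn M N) => n.
rewrite geq_max => /andP[/HM + nN].
by rewrite /u' ltnNge nN.
Qed.

Definition inv1 u : C := u^-1.
Definition inv2 u : C := u^-2.

Lemma inv_sub_bound u e d : 0 < d -> d <= cabs u -> d <= cabs (u - e) ->
  cabs ((u - e)^-1 - u^-1) <= cabs e / d ^+ 2.
Proof.
move=> d0 du de.
have u0 : u != 0 by apply/eqP => k; move: du; rewrite k cabs0; lra.
have e0 : u - e != 0 by apply/eqP => k; move: de; rewrite k cabs0; lra.
have -> : (u - e)^-1 - u^-1 = e * ((u - e) * u)^-1 by field; rewrite u0 e0.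
rewrite cabsM cabsV cabsM ler_wpM2l ?cabs_ge0// lef_pV2 ?posrE ?exprn_gt0//.
  by rewrite expr2 ler_pM// ltW.
by rewrite mulr_gt0//; lra.
Qed.

Lemma inv2_sub_bound u e d : 0 < d -> d <= cabs u -> d <= cabs (u - e) ->
  cabs ((u - e)^-2 - u^-2) <= cabs e * 2 / d ^+ 3.
Proof.
move=> d0 du de; have h := inv_sub_bound d0 du de.
have -> : (u - e)^-2 - u^-2 = ((u - e)^-1 - u^-1) * ((u - e)^-1 + u^-1).
  by rewrite -!exprVn; ring.
have -> : cabs e * 2 / d ^+ 3 = cabs e / d ^+ 2 * (2 / d) by field; rewrite gt_eqF.
rewrite cabsM ler_pM ?cabs_ge0//; apply: le_trans (cabsD _ _) _.
have a : cabs (u - e)^-1 <= d^-1 by rewrite cabsV lef_pV2 ?posrE//; lra.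
have b : cabs u^-1 <= d^-1 by rewrite cabsV lef_pV2 ?posrE//; lra.
lra.
Qed.

(** Refining by one level replaces each center by four points at distance
    l n / sqrt 2 from it, so the increments decay geometrically. *)
Lemma center_mean_converges l F z d k N : admissible l -> 0 < d -> 0 <= k ->
  away l z d N ->
  (forall u e, d / 2 <= cabs u -> d / 2 <= cabs (u - e) ->
    cabs (F (u - e) - F u) <= cabs e * k) ->
  exists v, tends (fun n => center_mean l n F z) v.
Proof.
move=> gl d0 k0 fz HF.
have d2 : 0 < d / 2 by lra.
have [N2 HN2] := admissible_small gl d0.
apply: (@geom_cauchy_from _ (k * l 0%N) (maxn N N2)) => n.
rewrite geq_max => /andP[nN nN2].
rewrite center_mean_succ.
have := center_mean_lin l n (fun u => corner_mean (fun p => F (u - (l n)%:C * p))) F 1 (-1) z.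
rewrite mul1r mulN1r => <-.
apply: center_mean_bound => c hc; rewrite mul1r mulN1r.
set u := z - c.
have -> : corner_mean (fun p => F (u - (l n)%:C * p)) - F u =
    corner_mean (fun p => F (u - (l n)%:C * p) - F u).
  by rewrite -{1}(corner_mean_cst (F u)) /corner_mean; ring.
have du := fz n c nN hc; rewrite -/u in du.
have l0 := admissible_gt0 n gl.
apply: corner_mean_bound => p cp.
have np : nrm ((l n)%:C * p) = l n / 2.
  by rewrite nrm_real -cp nrm_corner gtr0_norm// mulrA mulr1.
have np2 := cabs_nrm ((l n)%:C * p); rewrite np in np2.
apply: le_trans (HF _ _ _ _) _.
- by have := nrm_cabs u; lra.
- apply: le_trans (nrm_cabs _); have := nrm_sub u ((l n)%:C * p).
  have := HN2 n nN2; rewrite np; lra.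
rewrite mulrC -mulrA ler_wpM2l//; apply: (@le_trans _ _ (l n)); first lra.
apply: le_trans (admissible_geom n gl) _.
apply: ler_wpM2l; first exact: ltW (admissible_gt0 0 gl).
by rewrite -exprVn lerXn2r ?nnegrE//; lra.
Qed.

Lemma center_mean_inv_converges l z d N : admissible l -> 0 < d ->
  away l z d N ->
  exists v, tends (fun n => center_mean l n inv1 z) v.
Proof.
move=> gl d0 fz; have d2 : 0 < d / 2 by lra.
apply: (center_mean_converges (k := ((d / 2) ^+ 2)^-1) gl d0 _ fz).
  by rewrite invr_ge0 exprn_ge0// ltW.
by move=> u e; exact: inv_sub_bound.
Qed.

Lemma center_mean_inv2_converges l z d N : admissible l -> 0 < d ->
  away l z d N ->
  exists v, tends (fun n => center_mean l n inv2 z) v.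
Proof.
move=> gl d0 fz; have d2 : 0 < d / 2 by lra.
apply: (center_mean_converges (k := 2 / (d / 2) ^+ 3) gl d0 _ fz).
  by rewrite divr_ge0// exprn_ge0// ltW.
by move=> u e h1 h2; rewrite mulrA; exact: inv2_sub_bound.
Qed.

Definition cauchy_transform l z : C :=
  xget 0 [set v | tends (fun n => center_mean l n inv1 z) v].

Lemma cauchy_transform_tends l z d N : admissible l -> 0 < d -> away l z d N ->
  tends (fun n => center_mean l n inv1 z) (cauchy_transform l z).
Proof.
move=> gl d0 fz; rewrite /cauchy_transform; case: xgetP => [v _ //|].
by have [v hv] := center_mean_inv_converges gl d0 fz => /(_ v).
Qed.

(** The first order Taylor error of 1/u is h^2 / ((u + h) u^2), which is
    uniform over all centers at distance at least d. *)
Lemma cauchy_transform_deriv l z d N : admissible l -> 0 < d -> away l z d N ->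
  exists v, has_deriv (cauchy_transform l) z v.
Proof.
move=> gl d0 fz; have d2 : 0 < d / 2 by lra.
have [v hv] := center_mean_inv2_converges gl d0 fz.
exists (-1 * v).
apply: (has_deriv_lim (F := fun n z => center_mean l n inv1 z) (k := ((d / 2) ^+ 3)^-1)
   (N := N) d2 _ (tendsZ (-1) hv)).
  move=> h hd; apply: (@cauchy_transform_tends _ _ (d / 2) N) => //.
  by apply: away_nearby => //; have := nrm_cabs h; lra.
move=> n h nN hd; rewrite center_mean_translate.
have := center_mean_lin l n (fun u => inv1 (u + h)) inv1 1 (-1) z.
rewrite mul1r mulN1r => <-.
have := center_mean_lin l n (fun u => 1 * inv1 (u + h) + (-1) * inv1 u) inv2 1 h z.
have -> : - (-1 * center_mean l n inv2 z * h) = h * center_mean l n inv2 z by ring.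
rewrite mul1r => <-.
apply: center_mean_bound => c hc; set u := z - c.
have du := fz n c nN hc; rewrite -/u in du.
have cu := nrm_cabs u; have ch := nrm_cabs h.
have cuh : d / 2 <= cabs (u + h).
  have := nrm_cabs (u + h); have := nrmB (u + h) h; rewrite addrK; lra.
have u0 : u != 0 by apply/eqP => k; move: cu du; rewrite k cabs0; lra.
have uh0 : u + h != 0 by apply/eqP => k; move: cuh; rewrite k cabs0; lra.
have -> : 1 * (1 * inv1 (u + h) + -1 * inv1 u) + h * inv2 u =
    h ^+ 2 * ((u + h) * u ^+ 2)^-1.
  by rewrite /inv1 /inv2; field; rewrite u0 uh0.
rewrite cabsM cabsV cabsM !cabsX mulrC ler_wpM2r ?exprn_ge0 ?cabs_ge0//.
have c2 : d / 2 <= cabs u by lra.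
rewrite lef_pV2 ?posrE ?mulr_gt0 ?exprn_gt0//; try lra.
by rewrite exprS ler_pM ?exprn_ge0 ?lerXn2r ?nnegrE//; lra.
Qed.

(** The last term of [center_mean_inv_bound] disappears in the limit, because
    the centers stay at a positive distance from z. *)
Lemma cauchy_transform_bound z : ~ cantor (3 / 4) (@side R) z ->
  cabs (cauchy_transform (@side R) z) <= 3 / 11.
Proof.
have gl := side_admissible R.
move=> /(away_of_not_cantor gl)[d d0 [N fz]].
apply/ler_addgt0Pr => e e0.
have de : 0 < d * e by rewrite mulr_gt0.
have [M HM] := @pow_small R (1 / 4) (d * e) de ltac:(lra) ltac:(lra).
apply: (tends_le (N := maxn N M) (cauchy_transform_tends gl d0 fz)) => n.
rewrite geq_max => /andP[nN nM].
apply: le_trans (center_mean_inv_bound n z gl) _; apply: lerD (side_sum _ _) _.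
have h := fz n _ nN (is_center_residual (@side R) n z); rewrite subKr in h.
have h' := nrm_cabs (residual (@side R) z n).
have r0 : 0 < cabs (residual (@side R) z n) by lra.
rewrite ler_pdivrMr//; apply: le_trans (HM n nM) _.
rewrite mulrC ler_wpM2l//; lra.
Qed.

(** The measure has mass 1 and bounded support. *)
Lemma cauchy_transform_infty l e : admissible l -> 0 < e ->
  exists2 M : R, 0 < M &
  forall z, M <= cabs z -> ~ cantor (3 / 4) l z /\ cabs (z * cauchy_transform l z - 1) <= e.
Proof.
move=> gl e0; have l0 := admissible_gt0 0 gl.
exists (4 * l 0%N + 4 * l 0%N / e); first by rewrite addr_gt0 ?mulr_gt0 ?invr_gt0.
move=> z hz.
have q0 : 0 < 4 * l 0%N / e by rewrite !mulr_gt0 ?invr_gt0.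
have zn := cabs_nrm z.
have nz : 3 / 4 * l 0%N < nrm (residual l z 0) by rewrite /=; lra.
split; first by move=> /(_ 0%N); rewrite leNgt nz.
have fz := away_outside gl nz; have d0 : 0 < 1 / 28 * l 0%N by lra.
have T := tendsD (tendsZ z (cauchy_transform_tends gl d0 fz)) (tends_cst (-1)).
apply: (tends_le (N := 0%N) T) => n _.
have := center_mean_lin l n inv1 (fun=> 1) z (-1) z; rewrite center_mean_cst mulr1 => <-.
apply: center_mean_bound => c hc; rewrite /inv1.
have hcn := is_center_bound gl hc; have hcc := cabs_nrm c.
have zc : cabs z - cabs c <= cabs (z - c).
  by have := cabsD (z - c) c; rewrite subrK; lra.
have zc0 : z - c != 0 by apply/eqP => k; move: zc; rewrite k cabs0; lra.
have -> : z * (z - c)^-1 + -1 = c * (z - c)^-1 by field; rewrite zc0.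
rewrite cabsM cabsV ler_pdivrMr; last by lra.
have : 4 * l 0%N / e <= cabs (z - c) by lra.
rewrite ler_pdivrMr// mulrC; lra.
Qed.

(** A point of the Cantor set has centers of all high levels nearby, whereas z
    is at distance d from them. *)
Lemma cantor_open l z : admissible l -> ~ cantor (3 / 4) l z ->
  exists2 d : R, 0 < d & forall w, nrm (w - z) < d -> ~ cantor (3 / 4) l w.
Proof.
move=> gl /(away_of_not_cantor gl)[d d0 [N fz]].
have d2 : 0 < d / 2 by lra.
exists (d / 2) => // w wz cw.
have [M HM] := admissible_small gl d2.
have h := fz (maxn N M) _ (leq_maxl _ _) (is_center_residual l (maxn N M) w).
have := cw (maxn N M); have := HM (maxn N M) (leq_maxr _ _).
have := admissible_gt0 (maxn N M) gl.
have e : z - (w - residual l w (maxn N M)) = residual l w (maxn N M) - (w - z) by ring.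
rewrite e in h; have := nrmB (residual l w (maxn N M)) (w - z); lra.
Qed.

End CauchyTransform.

(** * Integrals of continuous functions over segments *)
Section Integral.
Variable R : realType.
Local Notation C := R[i].
Implicit Types (x y a b c e d M : R).
Notation mu := (@lebesgue_measure R).

Definition rintegral (f : R -> R) a b : R := \int[mu]_(x in `[a, b]) f x.

Definition rcontinuous (f : R -> R) a b := forall x, a <= x <= b ->
  forall e : R, 0 < e -> exists2 d : R, 0 < d &
  forall y, a <= y <= b -> `|y - x| < d -> `|f y - f x| <= e.

Lemma rcontinuous_within f a b : rcontinuous f a b ->
  {within `[a, b], continuous f}.
Proof.
move=> H; apply/subspace_continuousP => x; rewrite /= in_itv /= => xab.
apply/cvgrPdist_le => e e0; have [d d0 Hd] := H x xab e e0.
rewrite near_withinE; apply/nbhs_ballP; exists d => // y xy.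
rewrite /= in_itv /= => yab; rewrite distrC; apply: Hd => //; rewrite distrC.
exact: xy.
Qed.

Lemma rcontinuous_integrable f a b : rcontinuous f a b ->
  mu.-integrable `[a, b] (EFin \o f).
Proof.
move=> /rcontinuous_within H; apply: continuous_compact_integrable => //.
exact: segment_compact.
Qed.

Lemma rintegral_cst c a b : a <= b -> rintegral (fun=> c) a b = c * (b - a).
Proof.
move=> ab; rewrite /rintegral Rintegral_cst//.
have -> : fine (mu `[a, b]%classic) = fine (if (a%:E < b%:E)%E then (b%:E - a%:E)%E else 0%E).
  by congr fine; exact: (lebesgue_measure_itv `[a, b]).
rewrite lte_fin.
case: ltP => // ba; have -> : b = a by lra.
by rewrite subrr.
Qed.

Lemma rcontinuous_cst c a b : rcontinuous (fun=> c) a b.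
Proof. by move=> x _ e e0; exists 1 => // y _ _; rewrite subrr normr0 ltW. Qed.

Lemma integrable_scale f a b c : mu.-integrable `[a, b] (EFin \o f) ->
  mu.-integrable `[a, b] (EFin \o (fun x => c * f x)).
Proof.
move=> cf; have mI : measurable (`[a, b]%classic : set (measurableTypeR R)) by [].
exact: (integrableZl mI c cf).
Qed.

Lemma rintegral_lin f g a b c d : rcontinuous f a b -> rcontinuous g a b ->
  rintegral (fun x => c * f x + d * g x) a b = c * rintegral f a b + d * rintegral g a b.
Proof.
move=> /rcontinuous_integrable cf /rcontinuous_integrable cg; rewrite /rintegral RintegralD//.
- by rewrite !RintegralZl.
- exact: integrable_scale.
- exact: integrable_scale.
Qed.

Lemma rintegral_le f a b c : a <= b -> rcontinuous f a b ->
  (forall x, a <= x <= b -> f x <= c) -> rintegral f a b <= c * (b - a).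
Proof.
move=> ab cf H; rewrite -rintegral_cst//; apply: le_Rintegral => //.
all: try exact: rcontinuous_integrable.
all: exact: (rcontinuous_integrable (@rcontinuous_cst c a b)).
Qed.

Lemma rintegral_ge f a b c : a <= b -> rcontinuous f a b ->
  (forall x, a <= x <= b -> c <= f x) -> c * (b - a) <= rintegral f a b.
Proof.
move=> ab cf H; rewrite -rintegral_cst//; apply: le_Rintegral => //.
all: try exact: rcontinuous_integrable.
all: exact: (rcontinuous_integrable (@rcontinuous_cst c a b)).
Qed.

Lemma rintegral_cat f a b c : a <= c <= b -> rcontinuous f a b ->
  rintegral f a b = rintegral f a c + rintegral f c b.
Proof.
move=> /andP[ac cb] /rcontinuous_integrable cf; rewrite /rintegral.
have := @Rintegral_itvB R f (BLeft a) (BRight b) c cf.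
rewrite !bnd_simp => /(_ ac cb) E.
have -> : \int[mu]_(x in `[c, b]) f x = \int[mu]_(x in `]c, b]) f x.
  rewrite Rintegral_itv_obnd_cbnd//; apply: integrableS cf => //.
  by apply: subset_itvr; rewrite bnd_simp.
by rewrite -E addrC subrK.
Qed.

Definition ccontinuous (f : R -> C) a b := forall x, a <= x <= b ->
  forall e : R, 0 < e -> exists2 d : R, 0 < d &
  forall y, a <= y <= b -> `|y - x| < d -> cabs (f y - f x) <= e.

Definition cintegral (f : R -> C) a b : C :=
  rintegral (fun x => complex.Re (f x)) a b +i* rintegral (fun x => complex.Im (f x)) a b.

Lemma ccontinuous_Re f a b : ccontinuous f a b ->
  rcontinuous (fun x => complex.Re (f x)) a b.
Proof.
move=> H x xab e e0; have [d d0 Hd] := H x xab e e0; exists d => // y yab yx.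
by rewrite -ReN -ReD; apply: le_trans (Re_le_cabs _) _; exact: Hd.
Qed.

Lemma ccontinuous_Im f a b : ccontinuous f a b ->
  rcontinuous (fun x => complex.Im (f x)) a b.
Proof.
move=> H x xab e e0; have [d d0 Hd] := H x xab e e0; exists d => // y yab yx.
by rewrite -ImN -ImD; apply: le_trans (Im_le_cabs _) _; exact: Hd.
Qed.

Lemma rcontinuous_lin f g a b c d : rcontinuous f a b -> rcontinuous g a b ->
  rcontinuous (fun x => c * f x + d * g x) a b.
Proof.
move=> Hf Hg x xab e e0.
have k0 : 0 < `|c| + `|d| + 1 by have := normr_ge0 c; have := normr_ge0 d; lra.
have ek : 0 < e / (`|c| + `|d| + 1) by rewrite divr_gt0.
have [d1 d10 H1] := Hf x xab _ ek; have [d2 d20 H2] := Hg x xab _ ek.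
exists (Num.min d1 d2); first by rewrite lt_min d10.
move=> y yab; rewrite lt_min => /andP[/(H1 y yab) h1 /(H2 y yab) h2].
have -> : c * f y + d * g y - (c * f x + d * g x) =
  c * (f y - f x) + d * (g y - g x) by ring.
apply: le_trans (ler_normD _ _) _; rewrite !normrM.
have E : e = e / (`|c| + `|d| + 1) * (`|c| + `|d| + 1) by rewrite divfK// gt_eqF.
set k := e / _ in ek h1 h2 E; rewrite E.
have : `|c| * `|f y - f x| <= `|c| * k by rewrite ler_wpM2l.
have : `|d| * `|g y - g x| <= `|d| * k by rewrite ler_wpM2l.
lra.
Qed.

Lemma cintegral_lin f g a b (u v : C) : ccontinuous f a b ->
  ccontinuous g a b ->
  cintegral (fun x => u * f x + v * g x) a b = u * cintegral f a b + v * cintegral g a b.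
Proof.
move=> cf cg; have [rf jf] := (ccontinuous_Re cf, ccontinuous_Im cf).
have [rg jg] := (ccontinuous_Re cg, ccontinuous_Im cg).
apply: Ceq; rewrite ?ReD ?ImD ?ReM ?ImM /=.
  have -> : (fun x => complex.Re (u * f x + v * g x)) = (fun x =>
    1 * (complex.Re u * complex.Re (f x) + complex.Re v * complex.Re (g x)) +
    (-1) * (complex.Im u * complex.Im (f x) + complex.Im v * complex.Im (g x))).
    by apply/funext => x; rewrite ReD !ReM; ring.
  rewrite rintegral_lin; [|exact: rcontinuous_lin|exact: rcontinuous_lin].
  by rewrite !rintegral_lin//; ring.
have -> : (fun x => complex.Im (u * f x + v * g x)) = (fun x =>
    1 * (complex.Re u * complex.Im (f x) + complex.Re v * complex.Im (g x)) +
    1 * (complex.Im u * complex.Re (f x) + complex.Im v * complex.Re (g x))).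
  by apply/funext => x; rewrite ImD !ImM; ring.
rewrite rintegral_lin; [|exact: rcontinuous_lin|exact: rcontinuous_lin].
by rewrite !rintegral_lin//; ring.
Qed.

Lemma cintegral_cst (u : C) a b : a <= b ->
  cintegral (fun=> u) a b = (b - a)%:C * u.
Proof.
move=> ab; rewrite /cintegral !rintegral_cst//; apply: Ceq; rewrite ?ReCM ?ImCM /=; ring.
Qed.

Lemma cintegral_cat f a b c : a <= c <= b -> ccontinuous f a b ->
  cintegral f a b = cintegral f a c + cintegral f c b.
Proof.
move=> acb cf; apply: Ceq; rewrite ?ReD ?ImD /=; apply: rintegral_cat => //.
  exact: ccontinuous_Re.
exact: ccontinuous_Im.
Qed.

Lemma cintegral_bound f a b M : a <= b -> ccontinuous f a b ->
  (forall x, a <= x <= b -> cabs (f x) <= M) -> cabs (cintegral f a b) <= 2 * M * (b - a).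
Proof.
move=> ab cf H; apply: le_trans (cabs_le_ReIm _) _; rewrite /cintegral /=.
have k1 : `|rintegral (fun x => complex.Re (f x)) a b| <= M * (b - a).
  rewrite ler_norml -mulNr; apply/andP; split.
    apply: rintegral_ge => //; first exact: ccontinuous_Re.
    by move=> x /H h; have := Re_le_cabs (f x); rewrite ler_norml => /andP[]; lra.
  apply: rintegral_le => //; first exact: ccontinuous_Re.
  by move=> x /H h; have := Re_le_cabs (f x); rewrite ler_norml => /andP[]; lra.
have k2 : `|rintegral (fun x => complex.Im (f x)) a b| <= M * (b - a).
  rewrite ler_norml -mulNr; apply/andP; split.
    apply: rintegral_ge => //; first exact: ccontinuous_Im.
    by move=> x /H h; have := Im_le_cabs (f x); rewrite ler_norml => /andP[]; lra.
  apply: rintegral_le => //; first exact: ccontinuous_Im.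
  by move=> x /H h; have := Im_le_cabs (f x); rewrite ler_norml => /andP[]; lra.
lra.
Qed.

End Integral.

(** * Contour integrals over rectangles *)
Section Goursat.
Variable R : realType.
Local Notation C := R[i].
Implicit Types (x y a b e d M : R) (z u v c : C) (g f : C -> C).

Definition cont_at g z := forall e : R, 0 < e -> exists2 d : R, 0 < d &
  forall h, cabs h < d -> cabs (g (z + h) - g z) <= e.

Definition diff_at g z := exists l, has_deriv g z l.

Lemma diff_at_cont_at g z : diff_at g z -> cont_at g z.
Proof. by move=> [l /has_deriv_cont]. Qed.

Definition hor g y : R -> C := fun x => g (x +i* y).
Definition ver g x : R -> C := fun y => g (x +i* y).

Lemma hor_cont g y a b : (forall x, a <= x <= b -> cont_at g (x +i* y)) ->
  ccontinuous (hor g y) a b.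
Proof.
move=> H x xab e e0; have [d d0 Hd] := H x xab e e0; exists d => // t _ tx.
have -> : hor g y t = g ((x +i* y) + (t - x)%:C).
  by rewrite /hor; congr g; apply: Ceq; rewrite ?ReD ?ImD /=; ring.
by apply: Hd; rewrite cabs_real.
Qed.

Lemma ver_cont g x a b : (forall y, a <= y <= b -> cont_at g (x +i* y)) ->
  ccontinuous (ver g x) a b.
Proof.
move=> H y yab e e0; have [d d0 Hd] := H y yab e e0; exists d => // t _ ty.
have -> : ver g x t = g ((x +i* y) + 'i%C * (t - y)%:C).
  by rewrite /ver; congr g; apply: Ceq; rewrite ?ReD ?ImD ?ReM ?ImM /=; ring.
apply: Hd; rewrite cabsM cabs_real.
have -> : cabs ('i%C : C) = 1 by rewrite /cabs /= expr0n /= add0r expr1n sqrtr1.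
by rewrite mul1r.
Qed.

(** The integral along the positively oriented boundary. *)
Definition rect_int g x1 x2 y1 y2 : C :=
  cintegral (hor g y1) x1 x2 - cintegral (hor g y2) x1 x2 +
  'i%C * (cintegral (ver g x2) y1 y2 - cintegral (ver g x1) y1 y2).

Definition on_boundary (D : C -> Prop) x1 x2 y1 y2 :=
  [/\ forall x, x1 <= x <= x2 -> D (x +i* y1),
      forall x, x1 <= x <= x2 -> D (x +i* y2),
      forall y, y1 <= y <= y2 -> D (x1 +i* y) &
      forall y, y1 <= y <= y2 -> D (x2 +i* y)].

Definition on_rect (D : C -> Prop) x1 x2 y1 y2 :=
  forall x y, x1 <= x <= x2 -> y1 <= y <= y2 -> D (x +i* y).

Lemma on_rect_boundary D x1 x2 y1 y2 : x1 <= x2 -> y1 <= y2 ->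
  on_rect D x1 x2 y1 y2 -> on_boundary D x1 x2 y1 y2.
Proof.
by move=> hx hy H; split=> t ht; apply: H => //; rewrite ?lexx ?hx ?hy.
Qed.

Lemma rect_int_lin g f u v x1 x2 y1 y2 :
  on_boundary (cont_at g) x1 x2 y1 y2 -> on_boundary (cont_at f) x1 x2 y1 y2 ->
  rect_int (fun z => u * g z + v * f z) x1 x2 y1 y2 =
    u * rect_int g x1 x2 y1 y2 + v * rect_int f x1 x2 y1 y2.
Proof.
move=> [g1 g2 g3 g4] [f1 f2 f3 f4]; rewrite /rect_int.
have E1 := cintegral_lin u v (hor_cont g1) (hor_cont f1).
have E2 := cintegral_lin u v (hor_cont g2) (hor_cont f2).
have E3 := cintegral_lin u v (ver_cont g3) (ver_cont f3).
have E4 := cintegral_lin u v (ver_cont g4) (ver_cont f4).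
rewrite /hor /ver in E1 E2 E3 E4 *; rewrite E1 E2 E3 E4; ring.
Qed.

Lemma rect_int_bound g x1 x2 y1 y2 M : x1 <= x2 -> y1 <= y2 ->
  on_boundary (cont_at g) x1 x2 y1 y2 ->
  on_boundary (fun z => cabs (g z) <= M) x1 x2 y1 y2 ->
  cabs (rect_int g x1 x2 y1 y2) <= 4 * M * ((x2 - x1) + (y2 - y1)).
Proof.
move=> hx hy [g1 g2 g3 g4] [b1 b2 b3 b4]; rewrite /rect_int.
have B1 := cintegral_bound hx (hor_cont g1) b1.
have B2 := cintegral_bound hx (hor_cont g2) b2.
have B3 := cintegral_bound hy (ver_cont g3) b3.
have B4 := cintegral_bound hy (ver_cont g4) b4.
apply: le_trans (cabsD _ _) _; rewrite cabsM.
have -> : cabs ('i%C : C) = 1 by rewrite /cabs /= expr0n /= add0r expr1n sqrtr1.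
rewrite mul1r.
have := cabsB (cintegral (hor g y1) x1 x2) (cintegral (hor g y2) x1 x2).
have := cabsB (cintegral (ver g x2) y1 y2) (cintegral (ver g x1) y1 y2).
lra.
Qed.

Lemma rect_int_splitx g x1 x x2 y1 y2 : x1 <= x <= x2 ->
  (forall t, x1 <= t <= x2 -> cont_at g (t +i* y1)) ->
  (forall t, x1 <= t <= x2 -> cont_at g (t +i* y2)) ->
  rect_int g x1 x2 y1 y2 = rect_int g x1 x y1 y2 + rect_int g x x2 y1 y2.
Proof.
move=> hx h1 h2; rewrite /rect_int (cintegral_cat hx (hor_cont h1)) (cintegral_cat hx (hor_cont h2)).
ring.
Qed.

Lemma rect_int_splity g x1 x2 y1 y y2 : y1 <= y <= y2 ->
  (forall t, y1 <= t <= y2 -> cont_at g (x1 +i* t)) ->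
  (forall t, y1 <= t <= y2 -> cont_at g (x2 +i* t)) ->
  rect_int g x1 x2 y1 y2 = rect_int g x1 x2 y1 y + rect_int g x1 x2 y y2.
Proof.
move=> hy h1 h2; rewrite /rect_int (cintegral_cat hy (ver_cont h1)) (cintegral_cat hy (ver_cont h2)).
ring.
Qed.

Lemma affine_cont_at u v z : cont_at (fun z => u + v * z) z.
Proof. exact: has_deriv_cont (has_deriv_affine u v z). Qed.

Lemma rect_int_cst u x1 x2 y1 y2 : rect_int (fun=> u) x1 x2 y1 y2 = 0.
Proof. by rewrite /rect_int /hor /ver !subrr mulr0 addr0. Qed.

(** Opposite sides of the rectangle differ by a constant, so that no primitive
    is needed. *)
Lemma rect_int_affine u v x1 x2 y1 y2 : x1 <= x2 -> y1 <= y2 ->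
  rect_int (fun z => u + v * z) x1 x2 y1 y2 = 0.
Proof.
move=> hx hy; set g := fun z => _.
have ch y : ccontinuous (hor g y) x1 x2 by apply: hor_cont => x _; exact: affine_cont_at.
have cv x : ccontinuous (ver g x) y1 y2 by apply: ver_cont => y _; exact: affine_cont_at.
have Eh : cintegral (hor g y1) x1 x2 - cintegral (hor g y2) x1 x2 =
    (x2 - x1)%:C * (v * ('i%C * (y1 - y2)%:C)).
  have := cintegral_lin 1 (-1) (ch y1) (ch y2); rewrite mul1r mulN1r => <-.
  rewrite -cintegral_cst//; congr cintegral; apply/funext => x.
  by rewrite /hor /g; apply: Ceq; rewrite ?(ReD, ImD, ReM, ImM) /=; ring.
have Ev : cintegral (ver g x2) y1 y2 - cintegral (ver g x1) y1 y2 =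
    (y2 - y1)%:C * (v * (x2 - x1)%:C).
  have := cintegral_lin 1 (-1) (cv x2) (cv x1); rewrite mul1r mulN1r => <-.
  rewrite -cintegral_cst//; congr cintegral; apply/funext => y.
  by rewrite /ver /g; apply: Ceq; rewrite ?(ReD, ImD, ReM, ImM) /=; ring.
rewrite /rect_int Eh Ev !rmorphB /=; ring.
Qed.

Lemma cont_atD g f z : cont_at g z -> cont_at f z ->
  cont_at (fun z => g z + f z) z.
Proof.
move=> Hg Hf e e0; have e2 : 0 < e / 2 by lra.
have [d1 d10 H1] := Hg _ e2; have [d2 d20 H2] := Hf _ e2.
exists (Num.min d1 d2); first by rewrite lt_min d10.
move=> h; rewrite lt_min => /andP[/H1 h1 /H2 h2].
have -> : g (z + h) + f (z + h) - (g z + f z) =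
  (g (z + h) - g z) + (f (z + h) - f z) by ring.
apply: le_trans (cabsD _ _) _; lra.
Qed.

Lemma on_boundaryW (D D' : C -> Prop) x1 x2 y1 y2 : (forall z, D z -> D' z) ->
  on_boundary D x1 x2 y1 y2 -> on_boundary D' x1 x2 y1 y2.
Proof. by move=> H [h1 h2 h3 h4]; split=> t /[dup] ht; [move/h1|move/h2|move/h3|move/h4] => /H. Qed.

Lemma rect_int_quarter g x y a b e : 0 <= a -> 0 <= b ->
  on_rect (cont_at g) x (x + 2 * a) y (y + 2 * b) ->
  4 * e < cabs (rect_int g x (x + 2 * a) y (y + 2 * b)) ->
  exists x' y', [/\ x' = x \/ x' = x + a, y' = y \/ y' = y + b &
    e < cabs (rect_int g x' (x' + a) y' (y' + b))].
Proof.
move=> a0 b0 H.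
have xa : x <= x + a <= x + 2 * a by apply/andP; split; lra.
have yb : y <= y + b <= y + 2 * b by apply/andP; split; lra.
rewrite (rect_int_splitx xa); last 2 first.
- by move=> t ht; apply: H => //; apply/andP; split; lra.
- by move=> t ht; apply: H => //; apply/andP; split; lra.
rewrite (rect_int_splity yb); last 2 first.
- by move=> t ht; apply: H => //; apply/andP; split; lra.
- by move=> t ht; apply: H => //; apply/andP; split; lra.
rewrite (rect_int_splity (x1 := x + a) yb); last 2 first.
- by move=> t ht; apply: H => //; apply/andP; split; lra.
- by move=> t ht; apply: H => //; apply/andP; split; lra.
have -> : x + 2 * a = x + a + a by ring.
have -> : y + 2 * b = y + b + b by ring.
set A := rect_int _ _ _ _ _; set B := rect_int _ _ _ _ _.
set A' := rect_int _ _ _ _ _; set B' := rect_int _ _ _ _ _.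
have := cabsD (A + B) (A' + B'); have := cabsD A B; have := cabsD A' B'.
move=> h1 h2 h3 h4.
have [k1|k1] := ltP e (cabs A); first by exists x, y; split => //; left.
have [k2|k2] := ltP e (cabs B).
  by exists x, (y + b); split => //; [left|right].
have [k3|k3] := ltP e (cabs A').
  by exists (x + a), y; split => //; [right|left].
have [k4|k4] := ltP e (cabs B').
  by exists (x + a), (y + b); split => //; right.
by exfalso; clearbody A B A' B'; clear -h1 h2 h3 h4 k1 k2 k3 k4; lra.
Qed.

(** Bisection: some quarter of the rectangle carries at least a quarter of the
    integral, hence so does some rectangle of scale 2^-n with the fraction
    4^-n.  Near the common limit point g is affine up to a small
    multiple of the distance, and affine functions have integral 0, so the
    integral over a rectangle of scale 2^-n is a smaller multiple of 4^-n. *)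
Lemma goursat g x1 x2 y1 y2 : x1 <= x2 -> y1 <= y2 ->
  on_rect (diff_at g) x1 x2 y1 y2 -> rect_int g x1 x2 y1 y2 = 0.
Proof.
move=> hx hy H; apply: contrapT => I0.
have {}I0 : 0 < cabs (rect_int g x1 x2 y1 y2) by apply: cabs_gt0; apply/eqP.
set I := cabs _ in I0.
(* The summand 1 makes L positive when the rectangle is degenerate. *)
pose W := x2 - x1; pose V := y2 - y1; pose L := W + V + 1.
have W0 : 0 <= W by rewrite /W; lra.
have V0 : 0 <= V by rewrite /V; lra.
have L0 : 0 < L by rewrite /L; lra.
pose h n : R := (2 ^+ n)^-1.
have h0 n : 0 < h n by rewrite invr_gt0 exprn_gt0.
have hS n : h n = 2 * h n.+1 by rewrite /h exprS; field; rewrite gt_eqF// exprn_gt0.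
have h1 : h 0%N = 1 by rewrite /h expr0 invr1.
pose bad n x y := [/\ x1 <= x /\ x + W * h n <= x2, y1 <= y /\ y + V * h n <= y2 &
  I / 2 * h n ^+ 2 < cabs (rect_int g x (x + W * h n) y (y + V * h n))].
have bad0 : bad 0%N x1 y1.
  rewrite /bad h1 !mulr1 /W /V; split; try by split; lra.
  have -> : x1 + (x2 - x1) = x2 by ring.
  have -> : y1 + (y2 - y1) = y2 by ring.
  rewrite -/I expr1n; lra.
have step n x y : bad n x y -> exists p : R * R, bad n.+1 p.1 p.2 /\
    `|p.1 - x| <= W * h n.+1 /\ `|p.2 - y| <= V * h n.+1.
  move=> [[xa xb] [ya yb] hI].
  have hs := hS n; have hp := h0 n.+1.
  have a0 : 0 <= W * h n.+1 by rewrite mulr_ge0// ltW.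
  have b0 : 0 <= V * h n.+1 by rewrite mulr_ge0// ltW.
  have eW : W * h n = 2 * (W * h n.+1) by rewrite hs; ring.
  have eV : V * h n = 2 * (V * h n.+1) by rewrite hs; ring.
  rewrite eW eV in hI xb yb.
  have [||x' [y' [hx' hy' hI']]] := @rect_int_quarter g x y _ _ (I / 2 * h n.+1 ^+ 2) a0 b0.
  - move=> s t /andP[s1 s2] /andP[t1 t2]; apply: diff_at_cont_at; apply: H;
      apply/andP; split; lra.
  - by apply: le_lt_trans hI; rewrite hs !expr2; lra.
  exists (x', y') => /=; split; last first.
    split; [case: hx' => ->|case: hy' => ->]; rewrite ?subrr ?normr0//.
    - by rewrite addrC addKr ger0_norm.
    - by rewrite addrC addKr ger0_norm.
  split; last exact: hI'.
    by clear -hx' xa xb a0; case: hx' => ->; split; lra.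
  by clear -hy' ya yb b0; case: hy' => ->; split; lra.
have [F HF] : exists F : (nat * R * R) -> R * R, forall s, bad s.1.1 s.1.2 s.2 ->
    bad s.1.1.+1 (F s).1 (F s).2 /\
    `|(F s).1 - s.1.2| <= W * h s.1.1.+1 /\ `|(F s).2 - s.2| <= V * h s.1.1.+1.
  have [|F HF] := @choice (nat * R * R)%type (R * R)%type (fun s p =>
    bad s.1.1 s.1.2 s.2 -> bad s.1.1.+1 p.1 p.2 /\
    `|p.1 - s.1.2| <= W * h s.1.1.+1 /\ `|p.2 - s.2| <= V * h s.1.1.+1).
    move=> [[n x] y] /=; have [b|nb] := pselect (bad n x y); last by exists (0, 0).
    by have [p Hp] := step n x y b; exists p.
  by exists F.
pose fix q (n : nat) : R * R := if n is n'.+1 then F (n', (q n').1, (q n').2) else (x1, y1).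
have bq n : bad n (q n).1 (q n).2.
  elim: n => [//|n IH] /=; exact: (HF (n, (q n).1, (q n).2) IH).1.
have dq n : `|(q n.+1).1 - (q n).1| <= W / 2 / 2 ^+ n /\
            `|(q n.+1).2 - (q n).2| <= V / 2 / 2 ^+ n.
  have [_ /=] := HF (n, (q n).1, (q n).2) (bq n).
  have -> : W / 2 / 2 ^+ n = W * h n.+1.
    by rewrite /h exprS; field; rewrite gt_eqF// exprn_gt0.
  have -> // : V / 2 / 2 ^+ n = V * h n.+1.
  by rewrite /h exprS; field; rewrite gt_eqF// exprn_gt0.
have [X HX] := @real_geom_cauchy R (fun n => (q n).1) _ (fun n => (dq n).1).
have [Y HY] := @real_geom_cauchy R (fun n => (q n).2) _ (fun n => (dq n).2).
have {}HX n : `|(q n).1 - X| <= W * h n.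
  by have := HX n; rewrite /h mulrCA divff ?mulr1.
have {}HY n : `|(q n).2 - Y| <= V * h n.
  by have := HY n; rewrite /h mulrCA divff ?mulr1.
have small e : 0 < e -> exists n, L * h n < e.
  move=> e0; have e2 : 0 < e / (L + L) by rewrite divr_gt0// addr_gt0.
  have [n Hn] := half_pow_lt e2; exists n.
  have k : h n * (L + L) <= e.
    have LL : 0 < L + L by lra.
    by rewrite -(ler_pdivlMr _ _ LL); exact: (Hn n (leqnn n)).
  have := mulr_gt0 L0 (h0 n); rewrite mulrDr mulrC in k.
  by set m := L * h n in k *; lra.
have hX : x1 <= X <= x2.
  apply/andP; split; rewrite leNgt; apply/negP => k.
    have k0 : 0 < x1 - X by lra.
    have [n Hn] := small _ k0; have [[xa xb] _ _] := bq n.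
    have := HX n; rewrite ler_norml => /andP[k1 k2].
    have : W * h n <= L * h n by rewrite ler_wpM2r ?ltW// /L; lra.
    by move=> ?; have := h0 n; lra.
  have k0 : 0 < X - x2 by lra.
  have [n Hn] := small _ k0; have [[xa xb] _ _] := bq n.
  have := HX n; rewrite ler_norml => /andP[k1 k2].
  have : W * h n <= L * h n by rewrite ler_wpM2r ?ltW// /L; lra.
  have : 0 <= W * h n by rewrite mulr_ge0// ltW.
  by lra.
have hY : y1 <= Y <= y2.
  apply/andP; split; rewrite leNgt; apply/negP => k.
    have k0 : 0 < y1 - Y by lra.
    have [n Hn] := small _ k0; have [_ [xa xb] _] := bq n.
    have := HY n; rewrite ler_norml => /andP[k1 k2].
    have : V * h n <= L * h n by rewrite ler_wpM2r ?ltW// /L; lra.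
    by move=> ?; have := h0 n; lra.
  have k0 : 0 < Y - y2 by lra.
  have [n Hn] := small _ k0; have [_ [xa xb] _] := bq n.
  have := HY n; rewrite ler_norml => /andP[k1 k2].
  have : V * h n <= L * h n by rewrite ler_wpM2r ?ltW// /L; lra.
  have : 0 <= V * h n by rewrite mulr_ge0// ltW.
  by lra.
have [l Hl] := H X Y hX hY.
(* The resulting bound 8 e (L h)^2 = I h^2 / 4 contradicts I h^2 / 2 < |integral|. *)
pose e := I / (32 * L ^+ 2).
have e0 : 0 < e by rewrite divr_gt0// mulr_gt0// exprn_gt0.
have [d d0 Hd] := Hl e e0.
have d4 : 0 < d / 4 by lra.
have [n Hn] := small _ d4.
have [[xa xb] [ya yb] hI] := bq n.
set x := (q n).1 in xa xb hI; set y := (q n).2 in ya yb hI.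
pose Z : C := X +i* Y.
pose r z := 1 * g z + (-1) * ((g Z - l * Z) + l * z).
have Wh : 0 <= W * h n by rewrite mulr_ge0// ltW.
have Vh : 0 <= V * h n by rewrite mulr_ge0// ltW.
have LE : L * h n = W * h n + V * h n + h n by rewrite /L; ring.
have hn := h0 n.
have sub : on_rect (fun z => cont_at g z /\ cabs (z - Z) <= 2 * (L * h n))
    x (x + W * h n) y (y + V * h n).
  move=> s t /andP[s1 s2] /andP[t1 t2]; split.
    apply: diff_at_cont_at; apply: H; clear -xa xb ya yb s1 s2 t1 t2.
      by apply/andP; split; lra.
    by apply/andP; split; lra.
  apply: le_trans (cabs_le_ReIm _) _; rewrite ReD ImD ReN ImN /=.
  have := HX n; have := HY n; rewrite -/x -/y !ler_norml => /andP[k1 k2] /andP[k3 k4].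
  have : `|s - X| <= 2 * (W * h n) by clear -s1 s2 k3 k4; rewrite ler_norml; apply/andP; split; lra.
  have : `|t - Y| <= 2 * (V * h n) by clear -t1 t2 k1 k2; rewrite ler_norml; apply/andP; split; lra.
  rewrite LE; lra.
have xx : x <= x + W * h n by lra.
have yy : y <= y + V * h n by lra.
have bnd := on_rect_boundary xx yy sub.
have bg := on_boundaryW (fun z (p : _ /\ _) => p.1) bnd.
have ba : on_boundary (cont_at (fun z => (g Z - l * Z) + l * z))
    x (x + W * h n) y (y + V * h n).
  by split=> ? _; exact: affine_cont_at.
have E : rect_int g x (x + W * h n) y (y + V * h n) = rect_int r x (x + W * h n) y (y + V * h n).
  by rewrite /r rect_int_lin// rect_int_affine// mulr0 addr0 mul1r.
have br : on_boundary (fun z => cont_at r z /\ cabs (r z) <= e * (2 * (L * h n)))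
    x (x + W * h n) y (y + V * h n).
  apply: on_boundaryW bnd => z [cz hz]; split.
    have c1 : cont_at (fun z => 1 * g z) z.
      by move=> e' e'0; have [d' d'0 Hd'] := cz e' e'0; exists d' => // t; rewrite !mul1r; exact: Hd'.
    apply: cont_atD c1 _.
    move=> e' e'0; have [d' d'0 Hd'] := affine_cont_at (g Z - l * Z) l z e'0.
    by exists d' => // t /Hd'; rewrite -mulrBr mulN1r cabsN.
  have hz' : cabs (z - Z) < d by lra.
  have eZ : Z + (z - Z) = z by ring.
  have := Hd _ hz'; rewrite eZ => k.
  have -> : r z = g z - g Z - l * (z - Z) by rewrite /r; ring.
  by apply: le_trans k _; rewrite ler_wpM2l// ltW.
have := rect_int_bound xx yy (on_boundaryW (fun z (p : _ /\ _) => p.1) br)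
  (on_boundaryW (fun z (p : _ /\ _) => p.2) br).
rewrite -E => k; have {}hI := lt_le_trans hI k.
have : 4 * (e * (2 * (L * h n))) * (x + W * h n - x + (y + V * h n - y)) <=
   8 * e * (L * h n) ^+ 2.
  have -> : x + W * h n - x + (y + V * h n - y) = W * h n + V * h n by ring.
  have : e * (L * h n) * (W * h n + V * h n) <= e * (L * h n) * (L * h n).
    apply: ler_wpM2l; first by rewrite mulr_ge0 ?ltW// mulr_gt0.
    by rewrite LE; lra.
  rewrite expr2; lra.
have -> : 8 * e * (L * h n) ^+ 2 = I / 4 * h n ^+ 2.
  by rewrite /e; field; rewrite gt_eqF.
have : 0 < I * h n ^+ 2 by rewrite mulr_gt0// exprn_gt0.
lra.
Qed.

End Goursat.

(** * Square contours around a Cantor set *)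
Section Contour.
Variable R : realType.
Local Notation C := R[i].
Implicit Types (x y a b e d M T r : R) (z w u v c p q : C) (g f : C -> C)
  (l : nat -> R).

Definition square_int g c r : C :=
  rect_int g (complex.Re c - r) (complex.Re c + r) (complex.Im c - r) (complex.Im c + r).

Lemma nrm_box c z r : (nrm (z - c) <= r) =
  (complex.Re c - r <= complex.Re z <= complex.Re c + r) &&
  (complex.Im c - r <= complex.Im z <= complex.Im c + r).
Proof.
by rewrite nrm_le ReD ImD ReN ImN !ler_norml !lerBrDl !lerBlDl.
Qed.

Lemma on_square_boundary (D : C -> Prop) c r : 0 <= r ->
  (forall z, nrm (z - c) = r -> D z) ->
  on_boundary D (complex.Re c - r) (complex.Re c + r)
    (complex.Im c - r) (complex.Im c + r).
Proof.
move=> r0 H.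
have k t (m : R) : m - r <= t <= m + r -> `|t - m| <= r.
  by move=> /andP[h1 h2]; rewrite ler_norml; apply/andP; split; lra.
split=> t /k ht; apply: H; apply/eqP; rewrite eq_le nrm_le /nrm le_max ReD ImD ReN ImN /=.
- have -> : complex.Im c - r - complex.Im c = - r by ring.
  by rewrite normrN (ger0_norm r0) ht lexx orbT.
- have -> : complex.Im c + r - complex.Im c = r by ring.
  by rewrite (ger0_norm r0) ht lexx orbT.
- have -> : complex.Re c - r - complex.Re c = - r by ring.
  by rewrite normrN (ger0_norm r0) ht lexx.
- have -> : complex.Re c + r - complex.Re c = r by ring.
  by rewrite (ger0_norm r0) ht lexx.
Qed.

Lemma square_int_bound g c r M : 0 <= r ->
  (forall z, nrm (z - c) = r -> cont_at g z /\ cabs (g z) <= M) ->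
  cabs (square_int g c r) <= 16 * M * r.
Proof.
move=> r0 H.
have h1 : complex.Re c - r <= complex.Re c + r by lra.
have h2 : complex.Im c - r <= complex.Im c + r by lra.
have := rect_int_bound (M := M) h1 h2
  (on_square_boundary r0 (fun z hz => (H z hz).1))
  (on_square_boundary r0 (fun z hz => (H z hz).2)).
rewrite /square_int; lra.
Qed.

(** The frame between the two squares is cut into four rectangles, to each of
    which [goursat] applies. *)
Lemma square_int_frame g c r r' : 0 <= r' <= r ->
  (forall z, r' <= nrm (z - c) <= r -> diff_at g z) ->
  square_int g c r = square_int g c r'.
Proof.
move=> /andP[r0 rr] H.
have away (x y : R) : complex.Re c - r <= x <= complex.Re c + r ->
   complex.Im c - r <= y <= complex.Im c + r ->
   r' <= `|x - complex.Re c| \/ r' <= `|y - complex.Im c| -> diff_at g (x +i* y).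
  move=> hx hy k; apply: H; rewrite nrm_box /= hx hy /= andbT.
  by rewrite /nrm le_max ReD ImD ReN ImN /=; case: k => ->; rewrite ?orbT.
have fl (t m : R) : t <= m - r' -> r' <= `|t - m|.
  by move=> h; rewrite ler_normr; apply/orP; right; lra.
have fr (t m : R) : m + r' <= t -> r' <= `|t - m|.
  by move=> h; rewrite ler_normr; apply/orP; left; lra.
rewrite /square_int.
set x1 := complex.Re c - r in away *; set x2 := complex.Re c + r in away *.
set y1 := complex.Im c - r in away *; set y2 := complex.Im c + r in away *.
set x1' := complex.Re c - r'; set x2' := complex.Re c + r'.
set y1' := complex.Im c - r'; set y2' := complex.Im c + r'.
have X1 : x1 <= x1' by rewrite /x1 /x1'; lra.
have X2 : x1' <= x2' by rewrite /x1' /x2'; lra.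
have X3 : x2' <= x2 by rewrite /x2' /x2; lra.
have Y1 : y1 <= y1' by rewrite /y1 /y1'; lra.
have Y2 : y1' <= y2' by rewrite /y1' /y2'; lra.
have Y3 : y2' <= y2 by rewrite /y2' /y2; lra.
have L t : x1 <= t <= x1' -> r' <= `|t - complex.Re c|.
  by move=> /andP[_ h]; apply: fl.
have RR t : x2' <= t <= x2 -> r' <= `|t - complex.Re c|.
  by move=> /andP[h _]; apply: fr.
have B t : y1 <= t <= y1' -> r' <= `|t - complex.Im c|.
  by move=> /andP[_ h]; apply: fl.
have U t : y2' <= t <= y2 -> r' <= `|t - complex.Im c|.
  by move=> /andP[h _]; apply: fr.
clear fl fr H.
have xin t : x1 <= t <= x1' \/ x1' <= t <= x2' \/ x2' <= t <= x2 -> x1 <= t <= x2.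
  by move=> [|[]] /andP[h1 h2]; apply/andP; split; lra.
have yin t : y1 <= t <= y1' \/ y1' <= t <= y2' \/ y2' <= t <= y2 -> y1 <= t <= y2.
  by move=> [|[]] /andP[h1 h2]; apply/andP; split; lra.
have ey1 : y1 <= y1 <= y1' by rewrite lexx.
have ey2 : y2' <= y2 <= y2 by rewrite lexx Y3.
rewrite (rect_int_splitx (x := x1')); first last.
- by move=> t ht; apply: diff_at_cont_at; apply: away => //; [rewrite lexx andbT; lra|right; exact: U].
- by move=> t ht; apply: diff_at_cont_at; apply: away => //; [rewrite lexx /=; lra|right; exact: B].
- by apply/andP; split; lra.
rewrite (rect_int_splitx (x1 := x1') (x := x2')); first last.
- by move=> t ht; apply: diff_at_cont_at; apply: away => //;
    [case/andP: ht => *; apply/andP; split; lra|rewrite lexx andbT; lra|right; exact: U].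
- by move=> t ht; apply: diff_at_cont_at; apply: away => //;
    [case/andP: ht => *; apply/andP; split; lra|rewrite lexx /=; lra|right; exact: B].
- by apply/andP; split; lra.
have -> : rect_int g x1 x1' y1 y2 = 0.
  by apply: goursat => [||s t hs ht]; [lra|lra|apply: away => //; [apply: xin|left; exact: L]; left].
have -> : rect_int g x2' x2 y1 y2 = 0.
  by apply: goursat => [||s t hs ht]; [lra|lra|apply: away => //; [apply: xin|left; exact: RR]; right; right].
rewrite add0r addr0.
have ex1 : x1 <= x1' <= x1' by rewrite lexx X1.
have ex2 : x2' <= x2' <= x2 by rewrite lexx X3.
rewrite (rect_int_splity (y := y1')); first last.
- by move=> t ht; apply: diff_at_cont_at; apply: away => //; [apply: xin; right; right|left; exact: RR].
- by move=> t ht; apply: diff_at_cont_at; apply: away => //; [apply: xin; left|left; exact: L].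
- by apply/andP; split; lra.
rewrite (rect_int_splity (y1 := y1') (y := y2')); first last.
- by move=> t ht; apply: diff_at_cont_at; apply: away => //;
    [apply: xin; right; right|case/andP: ht => *; apply/andP; split; lra|left; exact: RR].
- by move=> t ht; apply: diff_at_cont_at; apply: away => //;
    [apply: xin; left|case/andP: ht => *; apply/andP; split; lra|left; exact: L].
- by apply/andP; split; lra.
have -> : rect_int g x1' x2' y1 y1' = 0.
  by apply: goursat => [||s t hs ht]; [lra|lra|
    apply: away => //; [apply: xin; right; left|apply: yin; left|right; exact: B]].
have -> : rect_int g x1' x2' y2' y2 = 0.
  by apply: goursat => [||s t hs ht]; [lra|lra|
    apply: away => //; [apply: xin; right; left|apply: yin; right; right|right; exact: U]].
by rewrite add0r addr0.
Qed.

Lemma square_int_quadrants g c r : 0 <= r ->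
  (forall z, nrm (z - c) <= r ->
    nrm (z - c) = r \/ complex.Re z = complex.Re c \/ complex.Im z = complex.Im c ->
    cont_at g z) ->
  square_int g c r =
    square_int g (c + r%:C * ((1 / 2) +i* (1 / 2))) (r / 2) +
    square_int g (c + r%:C * ((1 / 2) +i* (- (1 / 2)))) (r / 2) +
    square_int g (c + r%:C * ((- (1 / 2)) +i* (1 / 2))) (r / 2) +
    square_int g (c + r%:C * ((- (1 / 2)) +i* (- (1 / 2)))) (r / 2).
Proof.
move=> r0 H; rewrite /square_int !ReD !ImD !ReCM !ImCM /=.
set X := complex.Re c in H *; set Y := complex.Im c in H *.
have -> : X + r * (1 / 2) - r / 2 = X by field.
have -> : X + r * (1 / 2) + r / 2 = X + r by field.
have -> : X + r * - (1 / 2) - r / 2 = X - r by field.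
have -> : X + r * - (1 / 2) + r / 2 = X by field.
have -> : Y + r * (1 / 2) - r / 2 = Y by field.
have -> : Y + r * (1 / 2) + r / 2 = Y + r by field.
have -> : Y + r * - (1 / 2) - r / 2 = Y - r by field.
have -> : Y + r * - (1 / 2) + r / 2 = Y by field.
have X3 : X - r <= X <= X + r by apply/andP; split; lra.
have Y3 : Y - r <= Y <= Y + r by apply/andP; split; lra.
have [_ X2] := andP X3; have [X1 _] := andP X3.
have [_ Y2] := andP Y3; have [Y1 _] := andP Y3.
have mid (x y : R) : X - r <= x <= X + r -> Y - r <= y <= Y + r ->
    x = X \/ y = Y -> cont_at g (x +i* y).
  by move=> hx hy k; apply: H; [rewrite nrm_box /= hx hy|right].
have bx (x y : R) : X - r <= x <= X + r -> y = Y - r \/ y = Y + r -> cont_at g (x +i* y).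
  move=> hx hy; have yy : Y - r <= y <= Y + r by case: hy => ->; apply/andP; split; lra.
  have k : nrm ((x +i* y) - c) <= r by rewrite nrm_box /= hx yy.
  apply: (H _ k); left; apply/eqP; rewrite eq_le k /= /nrm le_max; apply/orP; right.
  rewrite ImD ImN /= -/Y ler_normr; case: hy => ->; apply/orP; [right|left]; lra.
have by' (x y : R) : Y - r <= y <= Y + r -> x = X - r \/ x = X + r -> cont_at g (x +i* y).
  move=> hy hx; have xx : X - r <= x <= X + r by case: hx => ->; apply/andP; split; lra.
  have k : nrm ((x +i* y) - c) <= r by rewrite nrm_box /= hy xx.
  apply: (H _ k); left; apply/eqP; rewrite eq_le k /= /nrm le_max; apply/orP; left.
  rewrite ReD ReN /= -/X ler_normr; case: hx => ->; apply/orP; [right|left]; lra.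
rewrite (rect_int_splitx X3); first last.
- by move=> t ht; apply: bx => //; right.
- by move=> t ht; apply: bx => //; left.
rewrite (rect_int_splity Y3); first last.
- by move=> t ht; apply: mid => //; left.
- by move=> t ht; apply: by' => //; left.
rewrite (rect_int_splity (x1 := X) Y3); first last.
- by move=> t ht; apply: by' => //; right.
- by move=> t ht; apply: mid => //; left.
ring.
Qed.

(** Distinct corners differ by 1 in some coordinate. *)
Lemma corners_far p q : corner p = p -> corner q = q -> p <> q ->
  1 <= nrm (p - q).
Proof.
move=> hp hq pq.
suff : 1 <= `|complex.Re p - complex.Re q| \/ 1 <= `|complex.Im p - complex.Im q|.
  by rewrite /nrm le_max ReD ImD ReN ImN => -[] ->; rewrite ?orbT.
move: hp hq pq; case: p => p1 p2; case: q => q1 q2; rewrite /corner /=.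
move=> [<- <-] [<- <-].
have e (x y : R) : (x = 1 / 2 \/ x = - (1 / 2)) -> (y = 1 / 2 \/ y = - (1 / 2)) ->
    x = y \/ 1 <= `|x - y|.
  by move=> [] -> [] ->; [left|right|right|left] => //; rewrite ler_normr; lra.
case: (e _ _ (half_sign_cases p1) (half_sign_cases q1)) => [->|h]; last by left.
case: (e _ _ (half_sign_cases p2) (half_sign_cases q2)) => [->|h]; last by right.
by move=> [].
Qed.

Lemma recenter_axis l z : complex.Re z = 0 \/ complex.Im z = 0 -> 0 < l 0%N ->
  l 0%N / 2 <= nrm (recenter l z).
Proof.
have half_sign0 : half_sign (0 : R) = 1 / 2 by rewrite /half_sign lexx.
move=> [] z0 l0; rewrite /recenter /nrm le_max.
  rewrite ReD ReN ReCM /= z0 half_sign0 sub0r normrN ger0_norm; lra.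
rewrite ImD ImN ImCM /= z0 half_sign0 sub0r normrN [X in _ || (_ <= X)]ger0_norm; lra.
Qed.

Lemma cantor_recenter l z : admissible l -> cantor (4 / 5) l z ->
  cantor (4 / 5) (tail l) (recenter l z).
Proof. by move=> gl H k; exact: (H k.+1). Qed.

(** Painleve's estimate.  A contour about a square splits into its four
    quadrants, whose contours shrink onto the children; after n generations
    there are 4^n contours of perimeter 8 * l n. *)
Lemma square_int_cantor n l c g : admissible l ->
  (forall z, nrm (z - c) <= l 0%N -> ~ cantor (4 / 5) l (z - c) ->
    diff_at g z /\ cabs (g z) <= 1) ->
  cabs (square_int g c (l 0%N)) <= 16 * (4 ^+ n * l n).
Proof.
elim: n l c => [|n IH] l c gl H.
  rewrite expr0 mul1r -[16 * _]/(16 * l 0%N) -[16]mulr1.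
  apply: square_int_bound; first exact: ltW (admissible_gt0 0 gl).
  move=> z hz; have [|k1 k2] := H z (ltac:(by rewrite hz)).
    by move/(_ 0%N); rewrite /= hz; have := admissible_gt0 0 gl; lra.
  by split => //; exact: diff_at_cont_at.
have l0 := admissible_gt0 0 gl; have l1 := admissible_gt0 1 gl; have [_ l01] := gl 0%N.
rewrite (square_int_quadrants (ltW l0)); last first.
  move=> z hz k; apply: diff_at_cont_at; apply: (H z hz _).1 => hc.
  case: k => [k|k].
    by have := hc 0%N; rewrite /= k; lra.
  have k0 : complex.Re (z - c) = 0 \/ complex.Im (z - c) = 0.
    by rewrite ReD ReN ImD ImN; case: k => ->; rewrite subrr; [left|right].
  have := hc 1%N; have := recenter_axis k0 l0; rewrite /=; lra.
have quad p : corner p = p ->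
    cabs (square_int g (c + (l 0%N)%:C * p) (l 0%N / 2)) <= 16 * (4 ^+ n * l n.+1).
  move=> hp; set c' := c + _.
  have ez z : z - c = (l 0%N)%:C * p + (z - c') by rewrite /c'; ring.
  have np : nrm ((l 0%N)%:C * p) = l 0%N / 2.
    by rewrite nrm_real -hp nrm_corner gtr0_norm// mulrA mulr1.
  have sub z : nrm (z - c') <= l 0%N / 2 -> nrm (z - c) <= l 0%N.
    by move=> hz; have := nrmD ((l 0%N)%:C * p) (z - c'); rewrite -ez np; lra.
  rewrite (@square_int_frame g c' (l 0%N / 2) (l 1%N)); last first.
  - move=> z /andP[h1 h2]; apply: (H z (sub z h2) _).1 => hc.
    have k1 := hc 1%N; rewrite /= /recenter in k1.
    have [e|/eqP ne] := eqVneq (corner (z - c)) p.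
      have := k1; have -> : z - c - (l 0%N)%:C * corner (z - c) = z - c'.
        by rewrite e ez; ring.
      lra.
    have f := corners_far (cornerK (z - c)) hp ne.
    have e : (l 0%N)%:C * (corner (z - c) - p) =
       (z - c') - (z - c - (l 0%N)%:C * corner (z - c)).
      by rewrite {2}ez; ring.
    have := nrmB (z - c') (z - c - (l 0%N)%:C * corner (z - c)).
    rewrite -e nrm_real gtr0_norm//.
    have : l 0%N * 1 <= l 0%N * nrm (corner (z - c) - p) by rewrite ler_pM2l.
    lra.
  - by apply/andP; split; lra.
  apply: (IH (tail l) c' (admissible_tail gl)) => z hz hc.
  rewrite /tail in hz.
  have hz' : nrm (z - c') < l 0%N / 2 by lra.
  apply: H; first by apply: sub; exact: ltW.
  move=> hcl; apply: hc.
  have := cantor_recenter gl hcl; rewrite /recenter.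
  have -> : corner (z - c) = p by rewrite ez -hp corner_stable// hp.
  by rewrite ez addrC addKr.
have q1 : corner ((1 / 2) +i* (1 / 2)) = (1 / 2) +i* (1 / 2) :> C.
  by rewrite /corner /= !half_sign_half.
have q2 : corner ((1 / 2) +i* (- (1 / 2))) = (1 / 2) +i* (- (1 / 2)) :> C.
  by rewrite /corner /= half_sign_half half_sign_mhalf.
have q3 : corner ((- (1 / 2)) +i* (1 / 2)) = (- (1 / 2)) +i* (1 / 2) :> C.
  by rewrite /corner /= half_sign_half half_sign_mhalf.
have q4 : corner ((- (1 / 2)) +i* (- (1 / 2))) = (- (1 / 2)) +i* (- (1 / 2)) :> C.
  by rewrite /corner /= !half_sign_mhalf.
have {}q1 := quad _ q1; have {}q2 := quad _ q2.
have {}q3 := quad _ q3; have {}q4 := quad _ q4.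
apply: le_trans (cabsD4 q1 q2 q3 q4) _.
by rewrite exprS le_eqVlt; apply/orP; left; apply/eqP; ring.
Qed.

(** Each side has length 2 T and contributes to the imaginary part an integrand
    T / (t^2 + T^2) >= 1 / (2 T). *)
Lemma square_int_inv T : 0 < T -> 4 <= cabs (square_int (fun z => z^-1) 0 T).
Proof.
move=> T0; have T0' := ltW T0.
have inv_cont_at (z : C) : nrm (z - 0) = T -> cont_at (fun z => z^-1) z.
  rewrite subr0 => hz; apply: has_deriv_cont; apply: has_deriv_inv.
  by apply/eqP => z0; move: hz T0; rewrite z0 /nrm /= normr0 maxxx => ->; rewrite ltxx.
have [b1 b2 b3 b4] := on_square_boundary T0' inv_cont_at.
rewrite /square_int; apply: le_trans (Im_le_cabs _).
rewrite !sub0r !add0r /= in b1 b2 b3 b4 *.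
rewrite ler_normr; apply/orP; left.
rewrite /rect_int.
have TT : - T <= T by lra.
have im (x y : R) : complex.Im ((x +i* y : C)^-1) = - (y / (x ^+ 2 + y ^+ 2)).
  by [].
have re (x y : R) : complex.Re ((x +i* y : C)^-1) = x / (x ^+ 2 + y ^+ 2).
  by [].
have den x : - T <= x <= T -> 0 < x ^+ 2 + T ^+ 2 <= 2 * T ^+ 2.
  move=> /andP[h1 h2]; have := sqr_ge0 x; have : 0 < T ^+ 2 by rewrite exprn_gt0.
  have : x ^+ 2 <= T ^+ 2 by rewrite !expr2; nra.
  by move=> *; apply/andP; split; lra.
have low x : - T <= x <= T -> 1 / (2 * T) <= T / (x ^+ 2 + T ^+ 2).
  move=> /den/andP[d0 d1]; rewrite ler_pdivlMr// mulrAC ler_pdivrMr ?mulr_gt0//.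
  rewrite mul1r; rewrite expr2 in d1 *; rewrite expr2 in d1; lra.
have one : 1 / (2 * T) * (T - - T) = 1 by field; rewrite gt_eqF.
have i1 : 1 <= rintegral (fun x => complex.Im (hor (fun z : C => z^-1) (- T) x)) (- T) T.
  rewrite -one; apply: rintegral_ge => //; first exact: ccontinuous_Im (hor_cont b1).
  by move=> x hx; rewrite /hor im mulNr opprK sqrrN; exact: low.
have i2 : rintegral (fun x => complex.Im (hor (fun z : C => z^-1) T x)) (- T) T <= - 1.
  rewrite -one -mulNr; apply: rintegral_le => //; first exact: ccontinuous_Im (hor_cont b2).
  by move=> x hx; rewrite /hor im lerN2; exact: low.
have i3 : 1 <= rintegral (fun y => complex.Re (ver (fun z : C => z^-1) T y)) (- T) T.
  rewrite -one; apply: rintegral_ge => //; first exact: ccontinuous_Re (ver_cont b4).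
  by move=> x hx; rewrite /ver re addrC; exact: low.
have i4 : rintegral (fun y => complex.Re (ver (fun z : C => z^-1) (- T) y)) (- T) T <= - 1.
  rewrite -one -mulNr; apply: rintegral_le => //; first exact: ccontinuous_Re (ver_cont b3).
  by move=> x hx; rewrite /ver re mulNr sqrrN lerN2 addrC; exact: low.
move: i1 i2 i3 i4; rewrite /hor /ver /=; lra.
Qed.

Lemma cont_at_scale u g z : cont_at g z -> cont_at (fun z => u * g z) z.
Proof.
move=> H e e0; have k0 : 0 < cabs u + 1 by have := cabs_ge0 u; lra.
have ek : 0 < e / (cabs u + 1) by rewrite divr_gt0.
have [d d0 Hd] := H _ ek; exists d => // h /Hd.
rewrite ler_pdivlMr// -mulrBr cabsM => k.
have := cabs_ge0 (g (z + h) - g z); have := cabs_ge0 u; lra.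
Qed.

(** The integrals of g over large squares vanish by [square_int_cantor].  They
    are also close to b times the integral of 1/z, which does not vanish. *)
Lemma no_residue l g u (b : C) : admissible l ->
  (forall e : R, 0 < e -> exists n, 4 ^+ n * l n <= e) ->
  (forall z, ~ cantor (4 / 5) l z -> diff_at g z /\ cabs (g z) <= 1) ->
  (forall e : R, 0 < e -> exists M, forall z, M <= cabs z ->
     cabs (z * (g z - u) - b) <= e) ->
  b = 0.
Proof.
move=> gl lv Hg Hb; have l0 := admissible_gt0 0 gl.
have sq0 T : l 0%N <= T -> square_int g 0 T = 0.
  move=> lT; rewrite (@square_int_frame g 0 T (l 0%N)); last first.
  - move=> z /andP[h _]; apply: (Hg z _).1 => /(_ 0%N) /=.
    rewrite subr0 in h; lra.
  - by apply/andP; split; lra.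
  apply: cabs_eq0; apply/eqP; rewrite eq_le cabs_ge0 andbT.
  apply/ler_addgt0Pr => e e0; rewrite add0r.
  have e16 : 0 < e / 16 by lra.
  have [n Hn] := lv _ e16.
  have k := @square_int_cantor n l 0 g gl.
  apply: le_trans (k _) _; last by lra.
  by move=> z _; rewrite subr0; exact: Hg.
apply: cabs_eq0; apply/eqP; rewrite eq_le cabs_ge0 andbT.
apply/ler_addgt0Pr => e e0; rewrite add0r.
have e4 : 0 < e / 4 by lra.
have [M HM] := Hb _ e4.
pose T := Num.max M (l 0%N).
have TM : M <= T by rewrite /T le_max lexx.
have Tl : l 0%N <= T by rewrite /T le_max lexx orbT.
have T0 : 0 < T by lra.
pose r z := 1 * g z + (-1) * (1 * (fun=> u) z + b * z^-1).
have nz z : nrm (z - 0) = T -> z != 0.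
  move=> hz; apply/eqP => z0; move: hz; rewrite z0 subr0 /nrm /= normr0 maxxx; lra.
have ci z : nrm (z - 0) = T -> cont_at (fun z => z^-1) z.
  by move=> /nz z0; apply: has_deriv_cont; apply: has_deriv_inv.
have cg z : nrm (z - 0) = T -> cont_at g z.
  rewrite subr0 => hz; apply: diff_at_cont_at; apply: (Hg z _).1 => /(_ 0%N) /=; lra.
have cu z : cont_at (fun=> u) z by exact: has_deriv_cont (has_deriv_cst u z).
have cub z : nrm (z - 0) = T -> cont_at (fun z => 1 * (fun=> u) z + b * z^-1) z.
  by move=> hz; apply: cont_atD; apply: cont_at_scale => //; exact: ci.
have bd D := @on_square_boundary D 0 T (ltW T0).
have E : square_int r 0 T = - (b * square_int (fun z => z^-1) 0 T).
  rewrite /square_int /r rect_int_lin; [|exact: bd cg|exact: bd cub].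
  rewrite -/(square_int g 0 T) sq0// mulr0 add0r rect_int_lin; last 2 first.
  - by apply: bd => z _.
  - exact: bd ci.
  by rewrite rect_int_cst; ring.
have B : cabs (square_int r 0 T) <= 16 * (e / 4 / T) * T.
  apply: square_int_bound; first exact: ltW.
  move=> z hz; split.
    by apply: cont_atD; apply: cont_at_scale; [exact: cg|exact: cub].
  have z0 := nz z hz; have cz := cabs_gt0 z0.
  have zT : T <= cabs z by have := nrm_cabs z; rewrite subr0 in hz; lra.
  have := HM z (le_trans TM zT).
  have -> : z * (g z - u) - b = z * r z by rewrite /r; field.
  rewrite cabsM => k; rewrite ler_pdivlMr//; apply: le_trans k.
  by rewrite mulrC ler_wpM2r ?cabs_ge0.
rewrite E cabsN cabsM in B.
have w := square_int_inv T0.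
have : cabs b * 4 <= cabs b * cabs (square_int (fun z => z^-1) 0 T).
  by rewrite ler_wpM2l ?cabs_ge0.
have E2 : 16 * (e / 4 / T) * T = 4 * e by field; rewrite gt_eqF.
rewrite E2 in B.
lra.
Qed.

End Contour.

(** * The sphere, the motion and the capacities *)
Section Sphere.
Variable R : realType.
Local Notation C := R[i].
Implicit Types (z w u : C) (x y d M : R).

Lemma Re_continuous : continuous (fun z : Cplx R => complex.Re z : R^o).
Proof.
move=> z A /nbhs_ballP[e e0 eA]; apply/nbhsCP; exists e => // w wz.
apply: eA; rewrite /ball /= -ReN -ReD; apply: le_lt_trans (Re_le_cabs _) _.
by rewrite cabs_dist.
Qed.

Lemma pair_continuous : continuous (fun p : R^o * R^o => (p.1 +i* p.2 :
  Cplx R)).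
Proof.
move=> [a b]; apply/cvgCP => e e0; have e2 : 0 < e / 2 by lra.
exists (ball (a : R^o) (e / 2), ball (b : R^o) (e / 2)).
  by split; exact: nbhsx_ballx.
move=> [c d] [h1 h2]; suff : cabs ((c +i* d) - (a +i* b)) <= e by [].
rewrite /ball /= in h1 h2.
apply: le_trans (cabs_le_ReIm _) _; rewrite ReD ReN ImD ImN /=.
rewrite distrC in h1; rewrite distrC in h2.
by have := ltW h1; have := ltW h2; move=> *; lra.
Qed.

Lemma box_compact M : compact [set z : Cplx R | nrm z <= M].
Proof.
have -> : [set z : Cplx R | nrm z <= M] =
    (fun p : R^o * R^o => (p.1 +i* p.2 : Cplx R)) @` (`[- M, M] `*` `[- M, M]).
  apply/seteqP; split=> [z|z [[a b] [/= ha hb] <-]].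
    rewrite /= nrm_le !ler_norml => /andP[h1 h2].
    exists (complex.Re z, complex.Im z); last by case: z {h1 h2}.
    by rewrite /= !in_itv.
  by rewrite /= nrm_le !ler_norml; move: ha hb; rewrite !in_itv /= => -> ->.
apply: continuous_compact.
  by apply: continuous_subspaceT; exact: pair_continuous.
by apply: compact_setX; exact: segment_compact.
Qed.

(** The real parts of a compact set are bounded. *)
Lemma compact_proper (W : set (Cplx R)) : compact W -> exists z, ~ W z.
Proof.
move=> cW; have cI : compact ((fun z : Cplx R => complex.Re z : R^o) @` W).
  apply: continuous_compact => //; apply: continuous_subspaceT.
  exact: Re_continuous.
have [M [_ HM]] := compact_bounded cI.
exists (`|M| + 2)%:C => hW.
have M1 : M < `|M| + 1 by have := ler_norm M; lra.
have := HM _ M1 (`|M| + 2); move=> /(_ (ex_intro2 _ _ _ hW erefl)).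
rewrite /= ger0_norm; have := normr_ge0 M; lra.
Qed.

(** Limits at infinity are unique because infinity is not isolated, that is,
    because the plane is not compact. *)
Lemma punctured_infty_proper : ProperFilter ((infty R : sphere R)^').
Proof.
apply: Build_ProperFilter_ex => A [W [cW _] WA].
have [z nWz] := compact_proper cW.
by exists (fin z); apply: WA => //; left; exists z.
Qed.

Lemma nbhs_infty M (A : set (sphere R)) :
  (forall z : Cplx R, M <= cabs z -> A (fin z)) -> (infty R)^' A.
Proof.
move=> H; exists [set z : Cplx R | nrm z <= M].
  split; first exact: box_compact.
  apply: compact_closed; [exact: norm_hausdorff|exact: box_compact].
move=> _ [[z /= nz <-] _|->]; last by rewrite eqxx.
apply: H; apply: le_trans (nrm_cabs z); rewrite leNgt; apply/negP => k.
by apply: nz; exact: ltW.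
Qed.

Lemma deriv_at_inftyE (g : sphere R -> Cplx R) (b : C) :
  (forall e : R, 0 < e -> exists M, forall z, M <= cabs z ->
     cabs (z * (g (fin z) - g (infty R)) - b) <= e) ->
  deriv_at_infty g = b.
Proof.
move=> H; have PF := punctured_infty_proper.
apply: cvg_lim; first exact: norm_hausdorff.
apply/cvgCP => e e0; have [M HM] := H e e0.
exact: (nbhs_infty (M := M)).
Qed.

Lemma unit_diskE z : unit_disk z <-> cabs z < 1.
Proof. by rewrite /unit_disk /= normE -(rmorph1 (real_complex R)) ltcR. Qed.

Lemma has_derivM (f g : C -> C) a l m : has_deriv f a l -> has_deriv g a m ->
  has_deriv (fun z => f z * g z) a (l * g a + f a * m).
Proof.
move=> Hf Hg e e0.
pose k := 2 + cabs l + cabs (f a) + cabs (g a).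
have l0 := cabs_ge0 l; have f0 := cabs_ge0 (f a); have g0 := cabs_ge0 (g a).
have k0 : 0 < k by rewrite /k; lra.
pose e' := Num.min 1 (e / k).
have e'0 : 0 < e' by rewrite /e' lt_min ltr01 divr_gt0.
have e'1 : e' <= 1 by rewrite /e' ge_min lexx.
have e'k : e' * k <= e by rewrite -ler_pdivlMr// /e' ge_min lexx orbT.
have [d1 d10 H1] := Hf e' e'0; have [d2 d20 H2] := Hg e' e'0.
have [d3 d30 H3] := has_deriv_cont Hg e'0.
exists (Num.min (Num.min d1 d2) d3); first by rewrite !lt_min d10 d20.
move=> h; rewrite !lt_min => /andP[/andP[/H1 h1 /H2 h2] /H3 h3].
have -> : f (a + h) * g (a + h) - f a * g a - (l * g a + f a * m) * h =
  (f (a + h) - f a - l * h) * g (a + h) + l * h * (g (a + h) - g a) +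
  f a * (g (a + h) - g a - m * h) by ring.
have ga : cabs (g (a + h)) <= cabs (g a) + 1.
  have := cabsD (g (a + h) - g a) (g a); rewrite subrK; lra.
set X := _ - l * h in h1 *; set Y := g (a + h) in h3 ga *.
set Z := _ - m * h in h2 *.
have hh := cabs_ge0 h.
have t1 : cabs (X * Y) <= e' * cabs h * (cabs (g a) + 1).
  by rewrite cabsM ler_pM ?cabs_ge0.
have t2 : cabs (l * h * (Y - g a)) <= cabs l * cabs h * e'.
  by rewrite !cabsM ler_pM ?mulr_ge0 ?cabs_ge0.
have t3 : cabs (f a * Z) <= cabs (f a) * (e' * cabs h).
  by rewrite cabsM ler_pM ?cabs_ge0.
have := cabsD (X * Y + l * h * (Y - g a)) (f a * Z).
have := cabsD (X * Y) (l * h * (Y - g a)).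
have : e' * k * cabs h <= e * cabs h by rewrite ler_wpM2r.
have : 0 <= e' * cabs h by rewrite mulr_ge0// ltW.
rewrite /k; lra.
Qed.

(** The factor 1/1000 beats the Lipschitz constant of the drift and keeps
    |s| below the bound 9/8 required by [power_series_deriv]. *)
Definition param (lam : C) : C := 1 + (1 / 1000)%:C * lam.

Definition motion (lam : Cplx R) (p : sphere R) : sphere R :=
  if p is Some z then fin (flow (param lam) (@side R) z) else infty R.

Definition initial_set : set (Cplx R) := cantor (3 / 4) (@side R).

Lemma param_close lam : cabs lam < 1 -> cabs (param lam - 1) <= 1 / 1000.
Proof.
have -> : param lam - 1 = (1 / 1000)%:C * lam by rewrite /param; ring.
rewrite cabsM cabs_real ger0_norm; lra.
Qed.

Lemma motion_deriv z a : cabs a < 1 ->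
  exists v, has_deriv (fun lam => flow (param lam) (@side R) z) a v.
Proof.
move=> a1; have gl := side_admissible R.
set l' := tail (@side R); set z' := recenter (@side R) z.
have sa : cabs (param a) <= 9 / 8.
  have := param_close a1; have := cabsD (param a - 1) 1.
  rewrite subrK cabs1; lra.
have [v Hv] := power_series_deriv (drift_coef_geom z' (admissible_tail gl)) sa.
have Hp : has_deriv param a (1 / 1000)%:C by exact: has_deriv_affine.
have HP := has_deriv_comp Hp Hv.
have Hq : has_deriv (fun lam => 0 + (1 / 1000)%:C * lam) a (1 / 1000)%:C.
  exact: has_deriv_affine.
have HM := has_derivM Hq HP.
have HA := has_deriv_comp HM (has_deriv_affine z 1 _).
eexists; apply: has_deriv_eq HA => lam /=.
by rewrite /flow /drift /param mul1r; congr (_ + _ * _); ring.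
Qed.

Lemma motion_holomorphic (p : sphere R) :
  holomorphic_to_sphere (@unit_disk R) (motion ^~ p).
Proof.
move=> a /unit_diskE a1; case: p => [z|].
  have [v Hv] := motion_deriv z a1.
  split.
  - pose f (lam : Cplx R) : Cplx R := flow (param lam) (@side R) z.
    have k : f @ a --> f a.
      apply/(cvgCP f (f a) (nbhs_filter a)) => e e0.
      have [d d0 Hd] := has_deriv_cont Hv e0.
      apply/nbhsCP; exists d => // b bd; have := Hd _ bd.
      by have -> : a + (b - a) = b by ring.
    by move=> A nA; exact: (k (Some @^-1` A) nA).
  - by move=> _; apply/complex_differentiableP; exists v.
  - move=> ne; apply/complex_differentiableP.
    have h0 : flow (param a) (@side R) z != 0.
      by apply/eqP => k; apply: ne; rewrite /motion k.
    by eexists; exact: has_deriv_comp Hv (has_deriv_inv h0).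
split.
- exact: cst_continuous.
- by move=> [].
- by move=> _; apply/complex_differentiableP; exists 0; exact: has_deriv_cst.
Qed.

Lemma motion_holomorphic_motion : holomorphic_motion setT motion.
Proof.
have gl := side_admissible R.
split=> [p _|lam /unit_diskE l1 [z|] [w|] _ _ //= [] E|[z|] _ //=].
- exact: motion_holomorphic.
- by congr Some; exact: flow_injective gl (param_close l1) E.
- by rewrite /param mulr0 addr0 /flow subrr mul0r addr0.
Qed.

Lemma initial_set_compact : compact initial_set.
Proof.
have gl := side_admissible R.
apply: (@subclosed_compact _ _ [set z : Cplx R | nrm z <= 3 / 4 * @side R 0%N]).
- rewrite -[initial_set]setCK; apply: open_closedC; rewrite openE => z nz.
  have [d d0 Hd] := cantor_open gl nz.
  by apply/nbhsCP; exists d => // b bz; apply: Hd; apply: le_lt_trans (nrm_cabs _) bz.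
- exact: box_compact.
- by move=> z /(_ 0%N).
Qed.

(** The value at infinity is the limit there. *)
Definition cauchy_on_sphere (p : sphere R) : Cplx R :=
  if p is Some z then cauchy_transform (@side R) z else 0.

Lemma fin_invE (w : C) : w != 0 -> fin_inv w = fin (w^-1 : Cplx R).
Proof. by rewrite /fin_inv => /negbTE ->. Qed.

Lemma cauchy_transform_diff_off z : ~ initial_set z ->
  exists v, has_deriv (cauchy_transform (@side R)) z v.
Proof.
have gl := side_admissible R.
by move=> /(away_of_not_cantor gl)[d d0 [N fz]]; exact: cauchy_transform_deriv gl d0 fz.
Qed.

(** In the chart at infinity the derivative at 0 is the mass of the measure,
    by [cauchy_transform_infty]. *)
Lemma cauchy_on_sphere_holomorphic :
  holomorphic_on_sphere (~` (@fin R @` initial_set)) cauchy_on_sphere.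
Proof.
have gl := side_admissible R.
split=> [z nz|w nw]; apply/complex_differentiableP.
  by apply: cauchy_transform_diff_off => sz; apply: nz; exists z.
have [w0|w0] := eqVneq w 0; last first.
  have nw' : ~ initial_set (w^-1 : C).
    by move=> sw; apply: nw; rewrite fin_invE//; exists (w^-1 : C).
  have [v Hv] := cauchy_transform_diff_off nw'.
  have cw := cabs_gt0 w0.
  eexists; apply: has_deriv_near cw _ (has_deriv_comp (has_deriv_inv w0) Hv).
  move=> u hu; rewrite /= fin_invE//; apply/eqP => u0.
  by move: hu; rewrite u0 sub0r cabsN ltxx.
rewrite {}w0 in nw *; exists 1 => e e0.
have [M M0 HM] := cauchy_transform_infty gl e0.
exists M^-1; first by rewrite invr_gt0.
have E0 : (cauchy_on_sphere \o @fin_inv R) 0 = 0 by rewrite /= /fin_inv eqxx.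
move=> h hM; rewrite add0r E0 subr0 mul1r.
have [->|h0] := eqVneq h 0; first by rewrite E0 subrr cabs0 mulr0.
have -> : (cauchy_on_sphere \o @fin_inv R) h = cauchy_transform (@side R) h^-1.
  by rewrite /= fin_invE.
have ch := cabs_gt0 h0.
have [_] := HM h^-1 (ltac:(rewrite cabsV -[M]invrK lef_pV2 ?posrE ?invr_gt0// ltW//)).
move=> k.
have -> : cauchy_transform (@side R) h^-1 - h = h * (h^-1 * cauchy_transform (@side R) h^-1 - 1).
  by field.
by rewrite cabsM mulrC ler_wpM2r ?cabs_ge0.
Qed.

(** The Cauchy transform is a competitor: it is bounded by 3/11 and has
    derivative 1 at infinity. *)
Lemma capacity_pos : (1 <= analytic_capacity initial_set)%E.
Proof.
have gl := side_admissible R.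
have D : deriv_at_infty cauchy_on_sphere = 1.
  apply: deriv_at_inftyE => e e0; have [M _ HM] := cauchy_transform_infty gl e0.
  by exists M => z /HM[_]; rewrite /= subr0.
apply: ereal_sup_ubound; exists cauchy_on_sphere.
  split; first exact: cauchy_on_sphere_holomorphic.
  case=> [z|] np; apply/unit_diskE; rewrite /cauchy_on_sphere ?cabs0//.
  have nz : ~ initial_set z by move=> sz; apply: np; exists z.
  have := cauchy_transform_bound nz; lra.
by rewrite D normr1.
Qed.

(** The derivative of a competitor at infinity is its residue there. *)
Lemma capacity_zero (K : set (Cplx R)) (l : nat -> R) : admissible l ->
  (forall e : R, 0 < e -> exists n, 4 ^+ n * l n <= e) ->
  K `<=` cantor (4 / 5) l -> (analytic_capacity K <= 0)%E.
Proof.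
move=> gl lv KE; apply: ge_ereal_sup => _ [g [[hf hi] gb] <-].
have h0 : (~` (@fin R @` K)) (fin_inv (0 : Cplx R)).
  by rewrite /fin_inv eqxx => -[].
have /complex_differentiableP[b Hb] := hi _ h0.
have Hb' : forall e : R, 0 < e -> exists M, forall z, M <= cabs z ->
    cabs (z * (g (fin z) - g (infty R)) - b) <= e.
  move=> e e0; have [d d0 Hd] := Hb e e0; exists (2 / d) => z hz.
  have d2 : 0 < 2 / d by rewrite divr_gt0.
  have cz : 0 < cabs z by lra.
  have z0 : z != 0 by apply/eqP => k; move: cz; rewrite k cabs0 ltxx.
  have hd : cabs z^-1 < d.
    rewrite cabsV -[d]invrK ltf_pV2 ?posrE ?invr_gt0//.
    apply: lt_le_trans hz; rewrite -[ltLHS]mul1r ltr_pM2r ?invr_gt0//; lra.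
  have := Hd _ hd; rewrite add0r.
  have -> : (g \o @fin_inv R) z^-1 = g (fin z).
    by rewrite /= fin_invE ?invr_eq0// invrK.
  have -> : (g \o @fin_inv R) 0 = g (infty R) by rewrite /= /fin_inv eqxx.
  move=> k.
  have -> : z * (g (fin z) - g (infty R)) - b =
     z * (g (fin z) - g (infty R) - b * z^-1) by field.
  rewrite cabsM; apply: le_trans (ler_wpM2l (ltW cz) k) _.
  by rewrite cabsV mulrCA divff ?gt_eqF// mulr1.
have b0 : b = 0.
  apply: (@no_residue R l (g \o @fin R) (g (infty R)) b gl lv _ Hb').
  move=> z nz; have np : (~` (@fin R @` K)) (fin z).
    by move=> [w Kw [wz]]; apply: nz; rewrite -wz; exact: KE.
  split; first by apply/complex_differentiableP; exact: hf.
  by apply: ltW; apply/unit_diskE; exact: gb.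
by rewrite (deriv_at_inftyE Hb') b0 normr0.
Qed.

Lemma moved_set_cantor t : 0 < t < 1 ->
  moved_set motion initial_set (- t)%:C `<=`
    cantor (4 / 5) (rescale (1 - t / 1000) (@side R)).
Proof.
move=> /andP[t0 t1] w [_ [z sz <-]] /= [<-].
have -> : param (- t)%:C = (1 - t / 1000)%:C.
  by rewrite /param -rmorphM -(rmorph1 (real_complex R)) -rmorphD /=; congr (_ %:C); ring.
apply: flow_cantor => //; first exact: side_admissible.
by apply/andP; split; lra.
Qed.

(** Contracting every generation by 1 - t / 1000 multiplies the length of
    level n by an exponentially small factor, which kills the growth (n + 12)^2. *)
Lemma capacity_moved t : 0 < t < 1 ->
  (analytic_capacity (moved_set motion initial_set (- t)%:C) <= 0)%E.
Proof.
move=> /[dup] /andP[t0 t1] /moved_set_cantor sub.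
have s1 : 0 < 1 - t / 1000 < 1 by apply/andP; split; lra.
apply: capacity_zero sub.
  by apply: admissible_rescale; [exact: side_admissible|case/andP: s1 => -> /ltW ->].
by move=> e e0; exact: side_length_vanishes.
Qed.

Lemma moved_set_at_0 : moved_set motion initial_set 0 = initial_set.
Proof.
have [_ _ H0] := motion_holomorphic_motion.
apply/seteqP; split=> [w [_ [z sz <-]]|w sw].
  by rewrite H0// => -[<-].
by exists (fin w); [exists w|rewrite H0].
Qed.

End Sphere.

Theorem theorem1p4 (R : realType) :
  exists (E : set (Cplx R)) (h : Cplx R -> sphere R -> sphere R),
    [/\ compact E,
        holomorphic_motion setT h,
        forall lam, unit_disk lam -> h lam (infty R) = infty R
      & ~ {within unit_disk (R := R),
             continuous (fun lam => analytic_capacity (moved_set h E lam))}].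
Proof.
exists (@initial_set R), (@motion R); split => //.
- exact: initial_set_compact.
- exact: motion_holomorphic_motion.
move=> /subspace_continuousP /(_ 0).
have d0 : unit_disk (0 : Cplx R) by apply/unit_diskE; rewrite cabs0.
move=> /(_ d0) Hc0.
have Hc (A : set (\bar R)) : nbhs (analytic_capacity (@initial_set R)) A ->
    within (@unit_disk R) (nbhs (0 : Cplx R))
      (fun lam => A (analytic_capacity (moved_set (@motion R) (@initial_set R) lam))).
  by move=> nA; apply: (Hc0 A); rewrite /from_subspace moved_set_at_0.
have N : nbhs (analytic_capacity (@initial_set R)) [set y | (0 < y)%E].
  apply: open_ereal_gt'; apply: lt_le_trans (capacity_pos R).
  by rewrite lte_fin.
have /nbhsCP[d dp Hd] := Hc _ N.
pose t : R := Num.min (1 / 2) (d / 2).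
have t0 : 0 < t by rewrite /t lt_min; apply/andP; split; lra.
have t1 : t <= 1 / 2 by rewrite /t ge_min lexx.
have td : t <= d / 2 by rewrite /t ge_min lexx orbT.
have ct : cabs (- t)%:C = t by rewrite cabs_real normrN gtr0_norm.
have := Hd (- t)%:C; rewrite subr0 ct => /(_ ltac:(lra)).
move=> /(_ _) /=.
have dt : unit_disk ((- t)%:C : Cplx R) by apply/unit_diskE; rewrite ct; lra.
move=> /(_ dt); rewrite ltNge capacity_moved//.
by apply/andP; split; lra.
Qed.
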